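(* Let $(D,X)$ be a Dyer system and let $Y\subseteq X$. The normaliser $\operatorname{N}_D(D_Y)=\{g\in D\mid gD_Yg^{-1}=D_Y\}$ of $D_Y$ in $D$ decomposes as an internal semidirect product $$\operatorname{N}_D(D_Y)=D_Y\rtimes\operatorname{Ribb}(Y,Y),$$ where the action of $\operatorname{Ribb}(Y,Y)$ on $D_Y$ is given by conjugation.
   Context: A Dyer graph is a finite simplicial graph $\Gamma$ with vertex set $V(\Gamma)$ and edge set $E(\Gamma)$, together with a vertex labelling $f\colon V(\Gamma)\to\mathbb{N}_{\geq 2}\cup\{\infty\}$ and an edge labelling $m\colon E(\Gamma)\to\mathbb{N}_{>2}\cup\{\infty\}$ such that for every edge $\{u,v\}\in E(\Gamma)$, if $f(v)\geq 3$ (including $f(v)=\infty$), then $m(u,v)=\infty$. The labelling $m$ is extended to all pairs of distinct vertices by $m(u,v)=2$ if $\{u,v\}\notin E(\Gamma)$. The associated Dyer group is $$D(\Gamma)=\langle V(\Gamma)\mid v^{f(v)}=1 \text{ for all } v \text{ with } f(v)<\infty,\ \underbrace{uvu\cdots}_{m(u,v)\text{ terms}}=\underbrace{vuv\cdots}_{m(u,v)\text{ terms}}\text{ for all } \{u,v\}\text{ with } m(u,v)\neq\infty\rangle.$$ A Dyer system is a pair $(D,X)$ where $D$ is a group and $X\subseteq D$ is a generating set such that there exist a Dyer graph $\Gamma$ and a group isomorphism $D(\Gamma)\to D$ mapping $V(\Gamma)$ bijectively onto $X$. For $Y\subseteq X$, $D_Y$ denotes the subgroup of $D$ generated by $Y$,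 and $\Gamma_Y$ the full subgraph of $\Gamma$ spanned by (the vertices corresponding to) $Y$; $D_Y$ is the Dyer group of $\Gamma_Y$. The order of an element $x$ is denoted $o(x)$. Spherical type: a Dyer group is of spherical type if its Dyer graph has no edge labelled $\infty$ and the subgroup generated by its standard generators of order $2$ (a Coxeter group) is finite. Ribbons: let $Y\subseteq X$ and $x\in X\setminus Y$, and let $\Gamma_U$ (with $U\subseteq Y\cup\{x\}$) be the connected component of $\Gamma_{Y\cup\{x\}}$ containing $x$. If $D_U$ is of spherical type, define $$r_{Y,x}=\begin{cases} w_U^{-1}w_{U\setminus\{x\}} & \text{if } o(x)=2,\\ x & \text{if } o(x)>2 \text{ (in which case } U=\{x\}),\end{cases}$$ where, for $o(x)=2$, all elements of $U$ have order $2$, $D_U$ is a finite Coxeter group, and $w_U$, $w_{U\setminus\{x\}}$ are the elements of maximal length in the finite Coxeter groups $D_U$, $D_{U\setminus\{x\}}$. There is a unique $Z\subseteq Y\cup\{x\}$ with $r_{Y,x}D_Yr_{Y,x}^{-1}=D_Z$; the element $r_{Y,x}$ is called an elementary $(Y,Z)$-ribbon, and $r_{Y,x}^{-1}$ is called an elementary $(Z,Y)$-ribbon. A $(Y,Y')$-ribbon is an element $r=r_q\cdots r_1$ such that there is a sequence $Y=Y^1,\dots,Y^{q+1}=Y'$ of subsets of $X$ for which each $r_i$ is an elementary $(Y^i,Y^{i+1})$-ribbon; the empty product ($q=0$) is allowed, so $1$ is a $(Y,Y)$-ribbon. $\operatorname{Ribb}(Y,Y')$ is the set of all $(Y,Y')$-ribbons;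 $\operatorname{Ribb}(Y,Y)$ is a subgroup of $D$. *)

(* Defs.v *)
From HB Require Import structures.
From mathcomp Require Import all_boot.
From mathcomp Require Import boolp classical_sets functions cardinality.

Set Implicit Arguments.
Unset Strict Implicit.
Unset Printing Implicit Defensive.

Local Open Scope classical_set_scope.
Local Open Scope group_scope.
Local Open Scope quotient_scope.

(** * Groups given by generators and relations *)

Section Presentation.
Variable V : choiceType.

(* The letter [(v, false)] stands for v and [(v, true)] for its inverse. *)
Definition word := seq (V * bool).

Variable R : word -> word -> Prop.

Inductive pres_eq : word -> word -> Prop :=
| pres_rel a b : R a b -> pres_eq a b
| pres_cancel v s : pres_eq [:: (v, s); (v, ~~ s)] [::]
| pres_refl a : pres_eq a a
| pres_sym a b : pres_eq a b -> pres_eq b a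
| pres_trans a b c : pres_eq a b -> pres_eq b c -> pres_eq a c
| pres_cat a b c d : pres_eq a b -> pres_eq c d -> pres_eq (a ++ c) (b ++ d).

Definition pres_eqb (a b : word) : bool := `[< pres_eq a b >].

Lemma pres_eqb_equiv : equiv_class_of pres_eqb.
Proof.
split.
- by move=> a; apply/asboolP; apply: pres_refl.
- by move=> a b; apply/asboolP/asboolP; apply: pres_sym.
- move=> b a c /asboolP ab /asboolP bc; apply/asboolP.
  exact: pres_trans ab bc.
Qed.

Canonical pres_equiv := EquivRelPack pres_eqb_equiv.

Definition presented := {eq_quot pres_equiv}.

HB.instance Definition _ := Choice.on presented.

Lemma pres_piP (a b : word) : \pi_presented a = \pi_presented b <-> pres_eq a b.
Proof.
split=> [/eqmodP /asboolP //|ab].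
by apply/eqmodP/asboolP.
Qed.

Lemma pres_repr (a : word) : pres_eq (repr (\pi_presented a)) a.
Proof. by apply/pres_piP; rewrite reprK. Qed.

Definition word_inv (a : word) : word := rev [seq (p.1, ~~ p.2) | p <- a].

Lemma word_inv_cat a b : word_inv (a ++ b) = word_inv b ++ word_inv a.
Proof. by rewrite /word_inv map_cat rev_cat. Qed.

Lemma word_invK : involutive word_inv.
Proof.
move=> a; rewrite /word_inv map_rev revK -map_comp -[RHS]map_id.
by apply: eq_map => -[v s] /=; rewrite negbK.
Qed.

Lemma pres_mulV a : pres_eq (a ++ word_inv a) [::].
Proof.
elim: a => [|[v s] a IHa]; first exact: pres_refl.
rewrite -cat1s word_inv_cat -catA (catA a).
apply: pres_trans (pres_cancel v s).
apply: (@pres_cat [:: (v, s)] [:: (v, s)] _ [:: (v, ~~ s)]).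
  exact: pres_refl.
exact: (pres_cat IHa (pres_refl _)).
Qed.

Lemma pres_Vmul a : pres_eq (word_inv a ++ a) [::].
Proof. by rewrite -{2}[a]word_invK; apply: pres_mulV. Qed.

Lemma pres_inv a b : pres_eq a b -> pres_eq (word_inv a) (word_inv b).
Proof.
move=> ab.
have h1 : pres_eq (word_inv a) (word_inv a ++ (b ++ word_inv b)).
  rewrite -{1}[word_inv a]cats0; apply: pres_cat; first exact: pres_refl.
  exact/pres_sym/pres_mulV.
apply: pres_trans h1 _; rewrite catA -[X in pres_eq _ X]cat0s.
apply: pres_cat; last exact: pres_refl.
apply: pres_trans (pres_Vmul a).
by apply: pres_cat; [exact: pres_refl|exact: pres_sym].
Qed.

Definition pres_one : presented := \pi_presented [::].
Definition pres_mul (x y : presented) : presented := \pi_presented (repr x ++ repr y).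
Definition pres_invg (x : presented) : presented := \pi_presented (word_inv (repr x)).

Lemma pres_mulE a b :
  pres_mul (\pi_presented a) (\pi_presented b) = \pi_presented (a ++ b).
Proof. by apply/pres_piP; apply: pres_cat; apply: pres_repr. Qed.

Lemma pres_invE a : pres_invg (\pi_presented a) = \pi_presented (word_inv a).
Proof. by apply/pres_piP; apply/pres_inv/pres_repr. Qed.

Lemma presentedP (x : presented) : exists a, x = \pi_presented a.
Proof. by exists (repr x); rewrite reprK. Qed.

Lemma pres_mulA : associative pres_mul.
Proof.
move=> x y z.
case: (presentedP x) (presentedP y) (presentedP z) => a -> [b ->] [c ->].
by rewrite !pres_mulE catA.
Qed.

Lemma pres_1mul : left_id pres_one pres_mul.
Proof. by move=> x; case: (presentedP x) => a ->; rewrite pres_mulE. Qed.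

Lemma pres_mul1 : right_id pres_one pres_mul.
Proof. by move=> x; case: (presentedP x) => a ->; rewrite pres_mulE cats0. Qed.

Lemma pres_mulVx : left_inverse pres_one pres_invg pres_mul.
Proof.
move=> x; case: (presentedP x) => a ->; rewrite pres_invE pres_mulE.
exact/pres_piP/pres_Vmul.
Qed.

Lemma pres_mulxV : right_inverse pres_one pres_invg pres_mul.
Proof.
move=> x; case: (presentedP x) => a ->; rewrite pres_invE pres_mulE.
exact/pres_piP/pres_mulV.
Qed.

HB.instance Definition _ := isGroup.Build presented
  pres_mulA pres_1mul pres_mul1 pres_mulVx pres_mulxV.

Definition pres_gen (v : V) : presented := \pi_presented [:: (v, false)].

End Presentation.

(** * Dyer graphs and Dyer groups *)

(* Labels in N u {oo} are encoded in [option nat], with [None] for oo.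
   Only the values of [elab] on edges are meaningful. *)
Record dyer_graph := DyerGraph {
  vertex :> finType;
  edge : rel vertex;
  vlab : vertex -> option nat;
  elab : vertex -> vertex -> option nat;
  edge_sym : symmetric edge;
  edge_irr : irreflexive edge;
  elab_sym : forall u v, edge u v -> elab u v = elab v u;
  vlab_ge2 : forall v n, vlab v = Some n -> 2 <= n;
  elab_gt2 : forall u v k, edge u v -> elab u v = Some k -> 2 < k;
  dyer_cond : forall u v, edge u v ->
    (if vlab v is Some n then 3 <= n else true) -> elab u v = None
}.

Section DyerGroup.
Variable G : dyer_graph.

Definition elab_ext (u v : G) : option nat :=
  if edge u v then elab u v else Some 2.

(* u v u ... with k letters *)
Definition alternating (u v : G) (k : nat) : word G :=
  mkseq (fun i => (if odd i then v else u, false)) k.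

Inductive dyer_rel : word G -> word G -> Prop :=
| dyer_power v n : vlab v = Some n -> dyer_rel (nseq n (v, false)) [::]
| dyer_braid u v k : u != v -> elab_ext u v = Some k ->
    dyer_rel (alternating u v k) (alternating v u k).

Definition dyer_group : groupType := presented dyer_rel.
Definition dyer_gen (v : G) : dyer_group := pres_gen dyer_rel v.

End DyerGroup.

(** * Subgroups of a (possibly infinite) group *)

Section Groups.
Variable D : groupType.
Implicit Types (x g : D) (Y H K N U : set D).

Definition is_subgroup H : Prop := group_closed (mem H).

Definition gen_by Y : set D := smallest is_subgroup Y.

Definition conj_set g H : set D := [set g * h * g^-1 | h in H].

Definition normaliser H : set D := [set g | conj_set g H = H].

(* N = H x| K inside D; K acts on H by conjugation since K `<=` N. *)
Definition internal_semidirect N H K : Prop :=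
  [/\ is_subgroup N, is_subgroup H /\ is_subgroup K,
      H `<=` N /\ K `<=` N,
      forall g, N g -> conj_set g H = H
    & H `&` K = [set 1] /\ N = [set h * k | h in H & k in K]].

(* [None] is the infinite order. *)
Definition elt_order x : option nat :=
  match pselect (exists n, (0 < n) && (x ^+ n == 1)) with
  | left exn => Some (ex_minn exn)
  | right _ => None
  end.

Definition is_product U n g : Prop :=
  exists s : seq D,
    [/\ size s = n, forall y, y \in s -> U y & g = \prod_(y <- s) y].

(* Coxeter length with respect to U; it is only used for sets U of involutions
   (so inverses of generators are not needed) and for g in [gen_by U]. *)
Definition cox_length U g : nat :=
  xget 0 [set n | is_product U n g /\ forall k, is_product U k g -> n <= k].

(* w_U; meaningful when U is the set of standard generators of a finite
   Coxeter group, where the element of maximal length is unique. *)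
Definition longest_elt U : D :=
  xget 1 [set w | gen_by U w /\
    forall g, gen_by U g -> cox_length U g <= cox_length U w].

End Groups.

(** * Dyer systems and ribbons *)

(* The graph and the isomorphism witnessing that (D, X) is a Dyer system are
   part of the record, because the ribbons below refer to the graph. *)
Record dyer_system (D : groupType) (X : set D) := DyerSystem {
  sys_graph : dyer_graph;
  sys_iso : dyer_group sys_graph -> D;
  sys_iso_morph : {morph sys_iso : a b / a * b};
  sys_iso_bij : bijective sys_iso;
  sys_iso_gen :
    set_bij [set: sys_graph] X (fun v => sys_iso (dyer_gen v));
  sys_gen : gen_by X = [set: D]
}.

Section Ribbons.
Variables (D : groupType) (X : set D) (S : dyer_system X).
Implicit Types (x r s : D) (Y Z W U : set D).

Let Gam := sys_graph S.

Definition std (v : Gam) : D := sys_iso (dyer_gen v).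

(* the edge relation of the full subgraph of the Dyer graph spanned by W *)
Definition sub_edge W : rel Gam :=
  [rel u v | [&& std u \in W, std v \in W & edge u v]].

(* the connected component containing x of the full subgraph spanned by W *)
Definition component W x : set D :=
  [set y | exists u v : Gam,
     [/\ std u = x, std v = y & connect (sub_edge W) u v]].

Definition spherical U : Prop :=
  (forall u v : Gam, sub_edge U u v -> elab u v <> None) /\
  finite_set (gen_by [set y | U y /\ elt_order y = Some 2]).

Definition ribbon_elt Y x : D :=
  let U := component (Y `|` [set x]) x in
  if elt_order x == Some 2
  then (longest_elt U)^-1 * longest_elt (U `\ x)
  else x.

(* r = r_{Y,x} for some x, with r D_Y r^-1 = D_Z *)
Definition direct_ribbon Y Z r : Prop :=
  exists x,
    [/\ Y `<=` X /\ (X `\` Y) x,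
        spherical (component (Y `|` [set x]) x),
        Z `<=` Y `|` [set x],
        conj_set (ribbon_elt Y x) (gen_by Y) = gen_by Z
      & r = ribbon_elt Y x].

Definition elem_ribbon Y Z r : Prop :=
  direct_ribbon Y Z r \/ direct_ribbon Z Y r^-1.

Inductive is_ribbon : set D -> set D -> D -> Prop :=
| ribbon_one Y : Y `<=` X -> is_ribbon Y Y 1
| ribbon_step Y Z Z' r s :
    is_ribbon Y Z r -> elem_ribbon Z Z' s -> is_ribbon Y Z' (s * r).

Definition Ribb Y Y' : set D := [set r | is_ribbon Y Y' r].

End Ribbons.

(* Main.v *)
(* The conjugates of the generators behave like the reflections of a Coxeter
   group: there is a cocycle N with N (x_i) supported at x_i, its support counts
   the syllables of a reduced expression, and there is an exchange condition.
   If g is shortest in g D_Y and g D_Y g^-1 = D_Z, then N is equivariant along g,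
   so g carries the generators Y onto Z. Let x_k be the last letter of such a
   g <> 1, let U be the component of x_k in Y + x_k, put J = U - x_k, and write
   g = g' v with v in D_U and g' shortest in g' D_U; by equivariance v maps J
   into U. If x_k is an involution, every reflection of D_U outside D_J is inverted
   by v, hence there are finitely many; connectedness of U then bounds the length on
   D_U, so D_U is finite and v is the quotient of two longest elements. Otherwise
   U = {x_k}. In both cases v is a ribbon, and one concludes by induction on the
   length of g. Infinite labels and orders are detected by a representation by
   pseudo-reflections over algC[X]. *)
Require Import Defs.
From mathcomp Require Import all_boot all_algebra all_field.
From mathcomp Require Import ring.
From mathcomp Require Import boolp classical_sets functions cardinality.

Set Implicit Arguments.
Unset Strict Implicit.
Unset Printing Implicit Defensive.

Local Open Scope group_scope.

(** A ribbon may use only components of spherical type, and no hypothesis provides them: finiteness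
    of [D_U] must be extracted from the single element [v]. The reflections outside [D_J] give a
    finite list. A reflection inside [D_J] is a [D_J]-conjugate of some [x_s]; connectedness yields
    a [D_J]-conjugate of [x_s] not commuting with [x_k], and conjugating that one by [x_k] moves it
    out of [D_J]. So every reflection inside is one outside reflection conjugated by another, the
    walls of [D_U] are finite in number, and a reduced word crosses each at most once. The cocycle
    comes from the presentation alone. Relations, however, never show that a generator is
    nontrivial, that its order is exactly its label, or that an edge prevents commutation; the
    representation supplies these facts. Its polynomial variable makes infinite labels visible as
    growth of degree: no element can begin with both ends of such an edge, whereas [v] would produce
    one that does. As [t ^ g] means [g^-1 * t * g], conjugation by [g] is written with [g^-1], and
    being shortest in [g D_Y] becomes a condition on [g^-1]. *)

Section Parabolic.
Variables (D : groupType) (I : finType) (x : I -> D).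
Implicit Types (A B U : {set I}) (g h t c d : D) (i j : I).

Inductive powers t : D -> Prop :=
| powers1 : powers t 1
| powersM c : powers t c -> powers t (t * c)
| powersV c : powers t c -> powers t (t^-1 * c).

Inductive par A : D -> Prop :=
| par1 : par A 1
| parM i g : i \in A -> par A g -> par A (x i * g)
| parV i g : i \in A -> par A g -> par A ((x i)^-1 * g).

Definition refl_of A t := exists h i, [/\ par A h, i \in A & t = x i ^ h].

Lemma powers_mul t c d : powers t c -> powers t d -> powers t (c * d).
Proof.
move=> tc td; elim: tc => [|e _ IH|e _ IH]; rewrite ?mul1g // -mulgA;
  by constructor.
Qed.

Lemma powers_id t : powers t t.
Proof. by rewrite -[X in powers _ X]mulg1; do 2!constructor. Qed.

Lemma powers_idV t : powers t t^-1.
Proof. by rewrite -[X in powers _ X]mulg1; do 2!constructor. Qed.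

Lemma powersVg t c : powers t c -> powers t c^-1.
Proof.
elim=> [|e _ IH|e _ IH]; rewrite ?invg1 ?invgM ?invgK; first exact: powers1.
  exact: powers_mul IH (powers_idV t).
exact: powers_mul IH (powers_id t).
Qed.

Lemma powers_conj t c h : powers t c -> powers (t ^ h) (c ^ h).
Proof.
elim=> [|e _ IH|e _ IH]; rewrite ?conj1g ?conjMg ?conjVg; by constructor.
Qed.

Lemma powers_commute t c : powers t c -> commute t c.
Proof.
elim=> [|e _ IH|e _ IH]; rewrite /commute ?mulg1 ?mul1g //.
  by rewrite -mulgA -IH.
by rewrite -mulgA -IH !mulgA mulgV mulVg.
Qed.

Lemma commute_conj t c : commute t c -> t ^ c = t.
Proof. by move=> tc; rewrite conjgE tc mulKg. Qed.

Lemma powers_fix t c :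
  powers t c -> [/\ t ^ c = t, t ^ c^-1 = t, c ^ t = c & c ^ t^-1 = c].
Proof.
move=> /powers_commute tc; have ct := commute_sym tc.
by split; apply: commute_conj => //; apply: commuteV.
Qed.

Lemma powers_expg t c :
  powers t c -> exists n, c = t ^+ n \/ c = t ^- n.
Proof.
elim=> [|e _ [n [->|->]]|e _ [n [->|->]]].
- by exists 0%N; left.
- by exists n.+1; left; rewrite expgS.
- case: n => [|n]; first by exists 1%N; left; rewrite expg0 invg1 mulg1.
  by exists n; right; rewrite expgSr invgM mulVKg.
- case: n => [|n]; first by exists 1%N; right; rewrite expg0 mulg1.
  by exists n; left; rewrite expgS mulKg.
by exists n.+1; right; rewrite expgSr invgM.
Qed.

Lemma powers_invol t c : t * t = 1 -> powers t c -> c = 1 \/ c = t.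
Proof.
move=> tt; have tV : t^-1 = t by apply: mulg1_eq.
by elim=> [|e _ [->|->]|e _ [->|->]]; rewrite ?tV ?tt ?mulg1; auto.
Qed.

Lemma par_mul A g h : par A g -> par A h -> par A (g * h).
Proof.
move=> Ag Ah; elim: Ag => [|i e iA _ IH|i e iA _ IH]; rewrite ?mul1g // -mulgA.
  exact: parM.
exact: parV.
Qed.

Lemma par_gen A i : i \in A -> par A (x i).
Proof. by move=> iA; rewrite -[x i]mulg1; apply/parM/par1. Qed.

Lemma par_genV A i : i \in A -> par A (x i)^-1.
Proof. by move=> iA; rewrite -[_^-1]mulg1; apply/parV/par1. Qed.

Lemma par_inv A g : par A g -> par A g^-1.
Proof.
elim=> [|i e iA _ IH|i e iA _ IH]; rewrite ?invg1 ?invgM ?invgK; first exact: par1.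
  by apply: par_mul IH _; apply: par_genV.
by apply: par_mul IH _; apply: par_gen.
Qed.

Lemma par_powers A t c : par A t -> powers t c -> par A c.
Proof.
move=> At; elim=> [|e _ IH|e _ IH]; first exact: par1.
  exact: par_mul.
by apply: par_mul => //; apply: par_inv.
Qed.

Lemma par_conj A g h : par A g -> par A h -> par A (g ^ h).
Proof. by move=> Ag Ah; do ?apply: par_mul => //; apply: par_inv. Qed.

Lemma par_sub A B g : A \subset B -> par A g -> par B g.
Proof.
move=> /fintype.subsetP AB; elim=> [|i e /AB iA _ IH|i e /AB iA _ IH].
- exact: par1.
- exact: parM.
exact: parV.
Qed.

Lemma refl_of_par A t : refl_of A t -> par A t.
Proof. by case=> h [i [Ah iA ->]]; apply: par_conj => //; apply: par_gen. Qed.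

Lemma refl_of_gen A i : i \in A -> refl_of A (x i).
Proof. by move=> iA; exists 1, i; split; rewrite ?conjg1 //; apply: par1. Qed.

Lemma refl_of_conj A t h : refl_of A t -> par A h -> refl_of A (t ^ h).
Proof.
move=> [k [i [Ak iA ->]]] Ah; exists (k * h), i; rewrite conjgM; split=> //.
exact: par_mul.
Qed.

Lemma refl_of_sub A B t : A \subset B -> refl_of A t -> refl_of B t.
Proof.
move=> AB [k [i [Ak iA ->]]]; exists k, i; split=> //; last exact: (fintype.subsetP AB).
exact: par_sub Ak.
Qed.

Lemma par_commute A g h :
  (forall i, i \in A -> commute g (x i)) -> par A h -> commute g h.
Proof.
move=> gA; elim=> [|i e /gA gi _ IH|i e /gA gi _ IH]; first exact: commute1.
  exact: commuteM.
by apply: commuteM => //; apply: commuteV.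
Qed.

Lemma par_set1 i g : par [set i] g -> powers (x i) g.
Proof.
elim=> [|j e /set1P-> _ IH|j e /set1P-> _ IH]; by constructor.
Qed.

Lemma par_conj_map A B g h :
  (forall i, i \in A -> par B (x i ^ g)) -> par A h -> par B (h ^ g).
Proof.
move=> AB; elim=> [|i e iA _ IH|i e iA _ IH]; rewrite ?conj1g ?conjMg ?conjVg.
- exact: par1.
- by apply: par_mul => //; apply: AB.
by apply: par_mul => //; apply/par_inv/AB.
Qed.

Lemma refl_of_conj_map A B g t :
  (forall i, i \in A -> exists2 j, j \in B & x i ^ g = x j) ->
  refl_of A t -> refl_of B (t ^ g).
Proof.
move=> AB [h [i [Ah iA ->]]]; have [j jB ij] := AB i iA.
exists (h ^ g), j; split=> //; last by rewrite -ij -!conjgM conjgC.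
apply: par_conj_map Ah => k /AB[l lB ->]; exact: par_gen.
Qed.

End Parabolic.

(** * The reflection cocycle *)

(* [N g t] is the product of the powers of the reflection [t] contributed by the
   syllables of [g]. Recording it as an element of [<t>] rather than as an
   exponent avoids a value group depending on the order of [t]. *)
Record reflection_cocycle (D : groupType) (I : finType) (x : I -> D)
    (N : D -> D -> D) : Prop := ReflectionCocycle {
  cocycle_inj : injective x;
  cocycle_neq1 : forall i, x i != 1;
  cocycle_generate : forall g, par x [set: I] g;
  cocycle_gen : forall i t, N (x i) t = if t == x i then x i else 1;
  cocycle_mul : forall g h t, N (g * h) t = N g t * N h (t ^ g) ^ g^-1
}.

Section Cocycle.
Variables (D : groupType) (I : finType) (x : I -> D) (N : D -> D -> D).
Implicit Types (A B U V : {set I}) (g h t c d u v : D) (i j : I).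
Implicit Types (p : I * D) (w : seq (I * D)).

Hypothesis Nx : reflection_cocycle x N.
Let x_inj := cocycle_inj Nx.
Let x_neq1 := cocycle_neq1 Nx.
Let x_generate := cocycle_generate Nx.
Let N_gen := cocycle_gen Nx.
Let N_mul := cocycle_mul Nx.

Lemma N_one t : N 1 t = 1.
Proof.
have := N_mul 1 1 t; rewrite mulg1 !conjg1 invg1 conjg1 => e.
by apply: (mulgI (N 1 t)); rewrite -e mulg1.
Qed.

Lemma N_inv g t : N g^-1 t = (N g (t ^ g^-1) ^ g)^-1.
Proof.
have := N_mul g^-1 g t; rewrite mulVg N_one invgK => /esym/mulg1_eq e.
by rewrite -e invgK.
Qed.

Lemma conjg_self t : t ^ t = t.
Proof. by rewrite conjgE mulKg. Qed.

Lemma conjg_eq_self t y : (t ^ y == y) = (t == y).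
Proof. by rewrite -[X in _ == X](conjg_self y) (inj_eq (conjg_inj y)). Qed.

Lemma conjgV_eq_self t y : (t ^ y^-1 == y) = (t == y).
Proof. by rewrite (can2_eq (conjgKV y) (conjgK y)) conjg_self. Qed.

(** The cocycle rule conjugates a power of [t ^ g] by [g^-1], which gives a power of [t] again; all
    contributions to one wall therefore commute. *)
Lemma N_powers g t : powers t (N g t).
Proof.
elim: (x_generate g) t => [t|i h _ _ IH t|i h _ _ IH t].
- by rewrite N_one; apply: powers1.
- rewrite N_mul N_gen; apply: powers_mul.
    by case: eqP => [->|_]; [apply: powers_id | apply: powers1].
  by have := powers_conj (x i)^-1 (IH (t ^ x i)); rewrite -conjgM mulgV conjg1.
rewrite N_mul invgK; apply: powers_mul.
  rewrite N_inv N_gen conjgV_eq_self; case: eqP => [->|_].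
    by rewrite conjg_self; apply: powers_idV.
  by rewrite conj1g invg1; apply: powers1.
by have := powers_conj (x i) (IH (t ^ (x i)^-1)); rewrite -conjgM mulVg conjg1.
Qed.

Lemma N_power_gen i c t : powers (x i) c -> N c t = if t == x i then c else 1.
Proof.
move=> ic; elim: ic t => [|e ie IH|e ie IH] t.
- by rewrite N_one if_same.
- rewrite N_mul N_gen IH conjg_eq_self; case: eqP => [tx|_]; last first.
    by rewrite conj1g mulg1.
  by case: (powers_fix ie) => _ _ _ ->.
rewrite N_mul N_inv N_gen invgK IH conjgV_eq_self; case: eqP => [tx|_].
  by rewrite conjg_self; case: (powers_fix ie) => _ _ -> _.
by rewrite !conj1g invg1 mulg1.
Qed.

(** * Syllable words, exchange and reduction *)

Definition ev w := \prod_(p <- w) p.2.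

(** A syllable is a whole nontrivial power of one generator, so sizes count syllables and not
    letters; this makes exchange uniform over all orders of generators. *)
Definition wf A w :=
  forall p, p \in w -> [/\ p.1 \in A, powers (x p.1) p.2 & p.2 != 1].

(* The reflections crossed by the successive syllables of [w]; a word is
   reduced exactly when they are pairwise distinct. *)
Fixpoint crossed w : seq D :=
  if w is p :: w' then x p.1 :: [seq t ^ p.2^-1 | t <- crossed w'] else [::].

Lemma ev_cons p w : ev (p :: w) = p.2 * ev w.
Proof. by rewrite /ev big_cons. Qed.

Lemma ev_cat w1 w2 : ev (w1 ++ w2) = ev w1 * ev w2.
Proof. by rewrite /ev big_cat. Qed.

Lemma size_crossed w : size (crossed w) = size w.
Proof. by elim: w => //= p w IH; rewrite size_map IH. Qed.

Lemma crossed_cat w1 w2 :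
  crossed (w1 ++ w2) = crossed w1 ++ [seq t ^ (ev w1)^-1 | t <- crossed w2].
Proof.
elim: w1 => [|p w IH] /=.
  rewrite -[LHS]map_id; apply: eq_map => t.
  by rewrite /ev big_nil invg1 conjg1.
rewrite IH map_cat -map_comp ev_cons; congr (_ :: _ ++ _).
by apply: eq_map => t /=; rewrite -conjgM invgM.
Qed.

Lemma wf_cons A p w : wf A (p :: w) ->
  [/\ p.1 \in A, powers (x p.1) p.2, p.2 != 1 & wf A w].
Proof.
move=> h; case: (h p (mem_head _ _)) => ? ? ?; split=> // q qw.
by apply: h; rewrite in_cons qw orbT.
Qed.

Lemma wf_consI A p w : p.1 \in A -> powers (x p.1) p.2 -> p.2 != 1 ->
  wf A w -> wf A (p :: w).
Proof. by move=> ? ? ? h q; rewrite in_cons => /orP[/eqP ->|/h]. Qed.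

Lemma wf_cat A w1 w2 : wf A w1 -> wf A w2 -> wf A (w1 ++ w2).
Proof. by move=> h1 h2 p; rewrite mem_cat => /orP[/h1|/h2]. Qed.

Lemma wf_sub A B w : A \subset B -> wf A w -> wf B w.
Proof.
by move=> /fintype.subsetP AB h p /h[/AB ? ? ?].
Qed.

Lemma crossed_refl A w t : wf A w -> t \in crossed w -> refl_of x A t.
Proof.
elim: w t => // p w IH t /wf_cons[pA pc _ Aw] /=.
rewrite in_cons => /orP[/eqP ->|/mapP[s /(IH _ Aw) As ->]].
  exact: refl_of_gen.
by apply: refl_of_conj => //; apply/par_inv/(par_powers _ pc)/par_gen.
Qed.

Lemma N_ev A w t : wf A w -> N (ev w) t != 1 -> t \in crossed w.
Proof.
elim: w t => [t _|p w IH t /wf_cons[pA pc _ Aw]].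
  by rewrite /ev big_nil N_one eqxx.
rewrite ev_cons N_mul (N_power_gen _ pc) /= in_cons.
case: (t =P x p.1) => //= _; rewrite mul1g conjg_eq1 => /(IH _ Aw) tw.
by apply/mapP; exists (t ^ p.2) => //; rewrite conjgK.
Qed.

(** When the walls are distinct only one syllable contributes to [t]. Hence [N] at [t] is that
    syllable conjugated by what precedes it, and multiplying by its inverse deletes exactly that
    syllable. *)
Lemma N_reduced A w t : wf A w -> uniq (crossed w) -> t \in crossed w ->
  N (ev w) t != 1 /\
  exists w', [/\ wf A w', ev w' = (N (ev w) t)^-1 * ev w & (size w').+1 = size w].
Proof.
elim: w t => // p w IH t /wf_cons[pA pc p1 Aw] /= /andP[xw uw].
rewrite ev_cons N_mul (N_power_gen _ pc) in_cons.
have px : x p.1 ^ p.2 = x p.1.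
  by case: (powers_fix pc).
case: (eqVneq t (x p.1)) => [-> _|tp /= /mapP[s sw ->]].
  have -> : N (ev w) (x p.1 ^ p.2) = 1.
    apply: contraNeq xw => /(N_ev Aw) h; apply/mapP.
    by exists (x p.1 ^ p.2); rewrite ?conjgK.
  by rewrite conj1g mulg1; split=> //; exists w; rewrite mulKg.
rewrite map_inj_uniq in uw; last exact: conjg_inj.
have [Ns [w' [Aw' ew' sw']]] := IH s Aw uw sw.
rewrite mul1g conjgKV conjg_eq1; split=> //; exists (p :: w'); split.
- exact: wf_consI.
- rewrite ev_cons ew' -conjVg conjgE invgK -!mulgA; congr (_ * (_ * _)).
  by rewrite mulKg.
by rewrite /= sw'.
Qed.

Lemma reduce A w : wf A w ->
  exists w', [/\ wf A w', ev w' = ev w, uniq (crossed w') & size w' <= size w].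
Proof.
elim: {w}(size w) {-2}w (leqnn (size w)) => [|n IH] w sw Aw.
  by exists w; split=> //; case: w sw Aw.
case: w sw Aw => [|p w] sw Aw; first by exists [::].
have [pA pc p1 {}Aw] := wf_cons Aw; have {}sw : size w <= n by [].
have [w1 [Aw1 ew1 uw1 sw1]] := IH w sw Aw.
rewrite ev_cons -ew1.
case: (boolP (x p.1 \in [seq t ^ p.2^-1 | t <- crossed w1])) => [xw|xw]; last first.
  exists (p :: w1); rewrite ev_cons /= xw ltnS; split=> //; first exact: wf_consI.
  by rewrite map_inj_uniq //; apply: conjg_inj.
have {}xw : x p.1 \in crossed w1.
  case/mapP: xw => s sw1' sE.
  have -> : x p.1 = s by rewrite -(conjgKV p.2 s) -sE; case: (powers_fix pc).
  by [].
(* The wall of the new syllable is already crossed, so exchange pulls the old contribution [d] to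
   the front, where it merges with [p.2] in the same cyclic group. *)
have [_ [w2 [Aw2 ew2 sw2]]] := N_reduced Aw1 uw1 xw.
set d := N (ev w1) (x p.1) in ew2.
have pd : powers (x p.1) (p.2 * d) by apply: powers_mul => //; apply: N_powers.
have -> : p.2 * ev w1 = p.2 * d * ev w2 by rewrite ew2 mulgA mulgK.
case: (eqVneq (p.2 * d) 1) => [->|pd1].
  have lw2 : size w2 <= n by rewrite (leq_trans _ sw) // (leq_trans _ sw1) // -sw2.
  have [w' [? ? ? sw']] := IH w2 lw2 Aw2; exists w'; rewrite mul1g; split=> //.
  by apply: leq_trans sw' _; rewrite ltnW // ltnS (leq_trans _ sw1) // -sw2.
have lw2 : size ((p.1, p.2 * d) :: w2) <= n by rewrite /= sw2 (leq_trans sw1).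
have [|w' [? ew' ? sw']] := IH _ lw2; first exact: wf_consI.
exists w'; split=> //; first by rewrite ew' ev_cons.
by apply: leq_trans sw' _; rewrite /= ltnW // ltnS sw2.
Qed.

Lemma par_word A g : par x A g -> exists w,
  [/\ wf A w, ev w = g & uniq (crossed w)].
Proof.
suff H : par x A g -> exists2 w, wf A w & ev w = g.
  move=> /H[w Aw eg]; have [w' [? ew' ? _]] := reduce Aw.
  by exists w'; rewrite ew'.
elim=> [|i h iA _ [w Aw <-]|i h iA _ [w Aw <-]].
- by exists [::]; rewrite // /ev big_nil.
- exists ((i, x i) :: w); rewrite ?ev_cons //.
  by apply: wf_consI => //=; apply: powers_id.
- exists ((i, (x i)^-1) :: w); rewrite ?ev_cons //.
  by apply: wf_consI => //=; rewrite ?invg_eq1 //; apply: powers_idV.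
Qed.

(** * Length and its relation to the support of the cocycle *)

Lemma len_spec g : exists n, exists w,
  [/\ wf [set: I] w, ev w = g, uniq (crossed w) & size w = n].
Proof.
by have [w [? ? ?]] := par_word (x_generate g); exists (size w), w.
Qed.

Definition len g : nat := projT1 (cid (len_spec g)).

Lemma len_word g : exists w,
  [/\ wf [set: I] w, ev w = g, uniq (crossed w) & size w = len g].
Proof. by rewrite /len; case: cid. Qed.

Lemma wfT A w : wf A w -> wf [set: I] w.
Proof. by apply: wf_sub; apply: finset.subsetT. Qed.

(** The walls of any reduced word form the support of the cocycle of its value, so two reduced words
    of one element have equal size and the choice made in [len] is harmless. *)
Lemma len_reduced A w : wf A w -> uniq (crossed w) -> len (ev w) = size w.
Proof.
move=> /wfT Aw uw; have [w' [Aw' ew' uw' <-]] := len_word (ev w).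
rewrite -!size_crossed; apply/eqP; rewrite eqn_leq !uniq_leq_size // => t tw.
  by apply: N_ev Aw' _; rewrite ew'; case: (N_reduced Aw uw tw).
by apply: N_ev Aw _; rewrite -ew'; case: (N_reduced Aw' uw' tw).
Qed.

Lemma len_le A w : wf A w -> len (ev w) <= size w.
Proof.
move=> Aw; have [w' [Aw' <- uw']] := reduce Aw.
by rewrite (len_reduced Aw').
Qed.

Lemma size_len_reduced A w : wf A w -> size w = len (ev w) -> uniq (crossed w).
Proof.
move=> Aw sw; have [w' [Aw' ew' uw' sw']] := len_word (ev w).
apply: (leq_size_uniq uw'); last by rewrite !size_crossed sw' sw.
by move=> t tw; apply: N_ev Aw _; rewrite -ew'; case: (N_reduced Aw' uw' tw).
Qed.

Lemma len_one : len 1 = 0%N.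
Proof.
have := @len_le [set: I] [::]; rewrite /ev big_nil => h.
by apply/eqP; rewrite -leqn0 h.
Qed.

Lemma len_eq0 g : len g = 0%N -> g = 1.
Proof.
have [w [_ <- _ <-]] := len_word g.
by move/size0nil => ->; rewrite /ev big_nil.
Qed.

Lemma len_mul g h : len (g * h) <= len g + len h.
Proof.
have [w [Aw eg _ <-]] := len_word g; have [w' [Aw' eh _ <-]] := len_word h.
by rewrite -eg -eh -ev_cat -size_cat; apply: len_le (wf_cat Aw Aw').
Qed.

Lemma len_powers i c : powers (x i) c -> len c <= 1.
Proof.
move=> ic; case: (eqVneq c 1) => [->|c1]; first by rewrite len_one.
have := @len_le [set: I] [:: (i, c)]; rewrite ev_cons /ev big_nil mulg1.
by apply; apply: wf_consI.
Qed.

Lemma len_exchange g t : N g t != 1 -> len ((N g t)^-1 * g) < len g.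
Proof.
have [w [Aw <- uw <-]] := len_word g => Nt.
have [_ [w' [Aw' <- <-]]] := N_reduced Aw uw (N_ev Aw Nt).
by rewrite ltnS; apply: len_le Aw'.
Qed.

Lemma len_mul_disjoint g h :
  (forall t, N g t != 1 -> N h (t ^ g) = 1) -> len (g * h) = len g + len h.
Proof.
have [w [Aw <- uw <-]] := len_word g; have [w' [Aw' <- uw' <-]] := len_word h.
move=> dis; rewrite -ev_cat (len_reduced (wf_cat Aw Aw')) ?size_cat //.
rewrite crossed_cat cat_uniq uw map_inj_uniq ?uw' ?andbT; last exact: conjg_inj.
apply/hasPn => t /mapP[s sw' ->]; apply/negP => tw.
have [/dis + _] := N_reduced Aw uw tw.
have [+ _] := N_reduced Aw' uw' sw'.
by rewrite conjgKV => /eqP.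
Qed.

Lemma N_mul_reduced g h t : len (g * h) = len g + len h ->
  N g t != 1 -> N (g * h) t != 1.
Proof.
have [w [Aw eg uw <-]] := len_word g; have [w' [Aw' eh uw' <-]] := len_word h.
rewrite -eg -eh -ev_cat -size_cat => /esym sww.
have Aww := wf_cat Aw Aw'; have uww := size_len_reduced Aww sww.
move=> /(N_ev Aw) tw; have [] // := N_reduced (t := t) Aww uww.
by rewrite crossed_cat mem_cat tw.
Qed.

Lemma N_par A g t : par x A g -> N g t != 1 -> refl_of x A t.
Proof.
by move=> /par_word[w [Aw <- _]] /(N_ev Aw); apply: crossed_refl.
Qed.

Lemma first_syllable A g : par x A g -> g != 1 ->
  exists2 i, i \in A & N g (x i) != 1.
Proof.
move=> /par_word[[|p w] [Aw <- uw]]; first by rewrite /ev big_nil eqxx.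
have [pA _ _ _] := wf_cons Aw; exists p.1 => //.
by have [] // := N_reduced (t := x p.1) Aw uw; rewrite /= mem_head.
Qed.

Lemma N_eq1 g : (forall t, N g t = 1) -> g = 1.
Proof.
move=> N1; apply/eqP/contraT => /(first_syllable (x_generate g))[i _].
by rewrite N1 eqxx.
Qed.

(** The cocycle rule makes [N (g^-1 * h)] trivial, and an element with trivial cocycle has no first
    syllable. *)
Lemma N_ext g h : (forall t, N g t = N h t) -> g = h.
Proof.
move=> Ngh; apply/esym/eqP; rewrite -(inj_eq (mulgI g^-1)) mulVg; apply/eqP.
by apply: N_eq1 => t; rewrite N_mul -Ngh -N_mul mulVg N_one.
Qed.

Lemma N_strip g i : N ((N g (x i))^-1 * g) (x i) = 1.
Proof.
have p := N_powers g (x i); rewrite N_mul (N_power_gen _ (powersVg p)) eqxx.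
case: (powers_fix p) => _ -> _ _.
by rewrite invgK conjg_self mulVg.
Qed.

(** At this wall the contributions of [h^-1] and [h] cancel as they do in [h^-1 * h]; what remains
    is the contribution of the middle generator. *)
Lemma N_refl i h : N (x i ^ h) (x i ^ h) = x i ^ h.
Proof.
have e : N h^-1 (x i ^ h) * N h (x i) ^ h = 1.
  by have := N_mul h^-1 h (x i ^ h); rewrite conjgK invgK mulVg N_one.
have ix := powers_commute (N_powers h (x i)).
rewrite {1}conjgE N_mul conjgK N_mul N_gen eqxx conjg_self invgK.
case: (powers_fix (N_powers h (x i))) => _ _ _ ->.
by rewrite ix conjMg mulgA e mul1g.
Qed.

(** * Reflections of parabolic subgroups and shortest coset representatives *)

Lemma refl_neq1 A t : refl_of x A t -> t != 1.
Proof. by case=> h [i [_ _ ->]]; rewrite conjg_eq1. Qed.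

(** A reflection crosses its own wall, and elements of [par x A] cross only reflections of [A];
    hence the conjugator [h] may be any element of the group. *)
Lemma par_refl A i h : par x A (x i ^ h) -> refl_of x A (x i ^ h).
Proof. by move/N_par; apply; rewrite N_refl conjg_eq1. Qed.

Lemma par_gen_mem A i : par x A (x i) -> i \in A.
Proof.
move=> /first_syllable/(_ (x_neq1 i))[j jA].
by rewrite N_gen; case: (x j =P x i) => [/x_inj <-|_] //; rewrite eqxx.
Qed.

Lemma refl_par A B t : refl_of x B t -> par x A t -> refl_of x A t.
Proof. by case=> h [i [_ _ ->]]; apply: par_refl. Qed.

(** This encodes that [u] is shortest in the coset of [par x A] acting on its left. *)
Definition left_min A u := forall t, refl_of x A t -> N u t = 1.

Lemma left_min_par A u : par x A u -> left_min A u -> u = 1.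
Proof.
move=> Au um; apply/eqP/contraT => /(first_syllable Au)[i iA].
by rewrite um ?eqxx //; apply: refl_of_gen.
Qed.

Lemma left_min_sub A B u : A \subset B -> left_min B u -> left_min A u.
Proof. by move=> AB um t /(refl_of_sub AB)/um. Qed.

Lemma left_decomp A u : exists h u', [/\ par x A h, left_min A u' & u = h * u'].
Proof.
elim: {u}(len u).+1 {-2}u (ltnSn (len u)) => // n IH u lu.
case: (pselect (left_min A u)) => [um|].
  by exists 1, u; split; rewrite ?mul1g //; apply: par1.
move=> /existsNP[t /not_implyP[At /eqP Nt]].
have lt : len ((N u t)^-1 * u) < n.
  by apply: leq_trans (len_exchange Nt) _; rewrite -ltnS.
have [h [u' [Ah um e]]] := IH _ lt; exists (N u t * h), u'; split=> //.
  by apply: par_mul => //; apply: par_powers (N_powers _ _); apply: refl_of_par.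
by rewrite -mulgA -e mulVKg.
Qed.

Lemma N_par1 A g t : par x A g -> ~ refl_of x A t -> N g t = 1.
Proof. by move=> Ag At; apply/eqP; apply: contra_notT At => /(N_par Ag). Qed.

Lemma N_decomp A h u t : left_min A u -> par x A h -> refl_of x A t ->
  N (h * u) t = N h t.
Proof.
move=> um Ah At; rewrite N_mul um ?conj1g ?mulg1 //; exact: refl_of_conj.
Qed.

(** If the [par x A] part of [u] were nontrivial, its first generator would also be crossed by [u],
    by [N_decomp]. *)
Lemma left_minP A u : (forall i, i \in A -> N u (x i) = 1) -> left_min A u.
Proof.
move=> u1; have [h [u' [Ah um uE]]] := left_decomp A u.
suff h1 : h = 1 by rewrite uE h1 mul1g.
apply/eqP/contraT => /(first_syllable Ah)[i iA].
by rewrite -(N_decomp um Ah (refl_of_gen x iA)) -uE u1 ?eqxx.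
Qed.

Lemma left_min_inv_conj A B u : left_min A u ->
  (forall t, refl_of x B t -> refl_of x A (t ^ u^-1)) -> left_min B u^-1.
Proof. by move=> um BA t /BA/um; rewrite N_inv => ->; rewrite conj1g invg1. Qed.

Lemma len_left_decomp A h u : left_min A u -> par x A h ->
  len (u^-1 * h) = len u^-1 + len h.
Proof.
move=> um Ah; apply: len_mul_disjoint => t; apply: contraNeq => /(N_par Ah) At.
by rewrite N_inv um ?conj1g ?invg1.
Qed.

(* [N] of a conjugate by [u^-1], [u] minimal, is the conjugate of [N], so
   [t] crosses no reflection but itself. *)
Lemma refl_conj_left_min A u t k : left_min A u -> refl_of x A t ->
  t ^ u = x k -> exists2 j, j \in A & t = x j.
Proof.
move=> um At tk; have pt := refl_of_par At.
have [j jA Ntj] := first_syllable pt (refl_neq1 At); exists j => //.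
have e : N (u^-1 * (t * u)) (x j ^ u) = (N t (x j)) ^ u.
  rewrite N_mul N_inv invgK conjgK N_mul !um ?conj1g ?invg1 ?mulg1 ?mul1g //.
    by apply: refl_of_conj => //; apply: refl_of_gen.
  exact: refl_of_gen.
apply: (conjg_inj u); rewrite tk; apply/esym/eqP.
move: e; rewrite -conjgE tk N_gen; case: (_ ^ _ =P _) => // _ /esym/eqP.
by rewrite conjg_eq1 (negPf Ntj).
Qed.

Definition centralised V i := [set j in V | x i * x j == x j * x i].

Lemma par_centralised V i t : par x (centralised V i) t -> commute (x i) t.
Proof. by apply: par_commute => j; rewrite inE => /andP[_ /eqP]. Qed.

(** Generators are stripped from [t] one at a time. If [t] crosses [x j], comparing both sides of
    [t' * x i = x i * t] at the wall [r] puts [r] into [par x V]; comparing [r * x i = x i * x j] at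
    the wall [x i] then forces [x i] and [x j] to commute. *)
Lemma par_conj_centralised V i t : i \notin V ->
  par x V t -> par x V (t ^ (x i)^-1) -> par x (centralised V i) t.
Proof.
move=> iV; have iVp : ~ par x V (x i) by move/par_gen_mem; rewrite (negPf iV).
elim: {t}(len t).+1 {-2}t (ltnSn (len t)) => // n IH t lt Vt Vt'.
case: (eqVneq t 1) => [->|t1]; first exact: par1.
have [j jV Nj] := first_syllable Vt t1.
have ij : x j != x i by apply: contraNneq iV => /x_inj <-.
pose r := x j ^ (x i)^-1; pose t' := t ^ (x i)^-1.
have tE : t' * x i = x i * t by rewrite /t' conjgE invgK mulgA mulgVK.
have Vr : par x V r.
  suff : N t' r != 1 by move/(N_par Vt')/refl_of_par.
  have : N (x i * t) r != 1.
    rewrite N_mul N_gen /r conjgV_eq_self (negPf ij) mul1g conjgKV.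
    by rewrite conjg_eq1.
  (* If the last letter [x i] contributed to the wall [r], it would be conjugate to [x j] by [t],
     hence lie in [par x V]. *)
  rewrite -tE N_mul N_gen; case: (r ^ t' =P x i) => [rt|_]; last by rewrite conj1g mulg1.
  case: iVp; have -> : x i = x j ^ t.
    apply: (conjg_inj (x i)^-1); rewrite -conjgM.
    have -> : t * (x i)^-1 = (x i)^-1 * t' by rewrite /t' conjgE invgK mulKg.
    by rewrite conjgM -/r rt -{1}(conjg_self (x i)) conjgK.
  by apply: par_conj => //; apply: par_gen.
have cij : x i * x j = x j * x i.
  have rE : r * x i = x i * x j by rewrite /r conjgE invgK mulgA mulgVK.
  have : N (x i * x j) (x i) != 1.
    rewrite N_mul !N_gen eqxx conjg_self [x i == x j]eq_sym (negPf ij) conj1g mulg1.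
    exact: x_neq1.
  rewrite -rE N_mul (N_par1 Vr) ?mul1g; last by move/refl_of_par.
  rewrite conjg_eq1 N_gen; case: (_ ^ _ =P _) => [ir _|_]; last by rewrite eqxx.
  have ri : x i * r = r * x i by rewrite conjgC ir.
  have rj : r = x j by apply: (mulgI (x i)); rewrite ri rE.
  by rewrite rj.
have jC : j \in centralised V i by rewrite inE jV cij eqxx.
pose c := N t (x j); have jc : powers (x j) c := N_powers _ _.
have Vc : par x V c by apply: par_powers jc; apply: par_gen.
rewrite -[t](mulVKg c); apply: par_mul.
  by apply: par_powers jc; apply: par_gen.
apply: IH.
- by apply: leq_trans (len_exchange Nj) _; rewrite -ltnS.
- by apply: par_mul => //; apply: par_inv.
rewrite conjMg conjVg; apply: par_mul => //; apply: par_inv.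
by apply: par_powers (powers_conj _ jc).
Qed.

(** * Prefixes and longest elements *)

Lemma len_gen i : len (x i) = 1%N.
Proof.
apply/eqP; rewrite eqn_leq (len_powers (powers_id _)) lt0n.
by apply: contraNneq (x_neq1 i) => /len_eq0 ->.
Qed.

Lemma len_powers_mul i c g : powers (x i) c -> N g (x i) = 1 ->
  len (c * g) = len c + len g.
Proof.
move=> ic Ng; apply: len_mul_disjoint => t; rewrite (N_power_gen _ ic).
case: (t =P x i) => [->|_]; last by rewrite eqxx.
by case: (powers_fix ic) => -> _ _ _.
Qed.

(** This is the weak order: [u] begins some reduced word of [g]. *)
Definition prefix u g := len g = len u + len (u^-1 * g).

Lemma N_prefix u g t : prefix u g -> N u t != 1 -> N g t != 1.
Proof.
by rewrite /prefix -{1}(mulVKg u g) => /N_mul_reduced h /h; rewrite mulVKg.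
Qed.

(** As [u] does not cross [x i], the syllable stripped from [g] is stripped from the remainder
    [u^-1 * g] as well. The remainder gets shorter by at least one and [g] by at most one, so
    lengths still add. *)
Lemma prefix_strip u g i : prefix u g -> N u (x i) = 1 ->
  prefix u ((N g (x i))^-1 * g).
Proof.
move=> wg Nw; set d := N g (x i).
case: (eqVneq d 1) => [->|d1]; first by rewrite invg1 mul1g.
set e := u^-1 * g in wg.
have Ne : N e (x i ^ u) = d ^ u.
  by rewrite /d -(mulVKg u g) -/e N_mul Nw mul1g conjgKV.
have eE : u^-1 * (d^-1 * g) = (N e (x i ^ u))^-1 * e.
  by rewrite Ne conjgE !invgM invgK /e !mulgA mulgK.
have lt : len (u^-1 * (d^-1 * g)) < len e.
  by rewrite eE len_exchange // Ne conjg_eq1.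
apply/eqP; rewrite eqn_leq; apply/andP; split.
  by rewrite -{1}(mulVKg u (d^-1 * g)) len_mul.
have := len_mul d (d^-1 * g); rewrite mulVKg wg => le1.
rewrite -(leq_add2l (len d)); apply: leq_trans le1.
rewrite addnCA leq_add2l; apply: leq_trans lt.
by rewrite -add1n leq_add2r (len_powers (N_powers g (x i))).
Qed.

Lemma prefix_cons u g i c : prefix u g -> N u (x i) = 1 -> N g (x i) = 1 ->
  powers (x i) c -> prefix (c * u) (c * g).
Proof.
move=> wg Nw Ng ic; rewrite /prefix !(len_powers_mul ic) // wg addnA.
by rewrite invgM -mulgA mulKg.
Qed.

Definition longest U a := par x U a /\ forall g, par x U g -> len g <= len a.

Lemma longest_exists U n : (forall g, par x U g -> len g <= n) ->
  exists a, longest U a.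
Proof.
move=> bn; pose P m := `[< exists2 g, par x U g & len g = m >].
have exP : exists m, P m by exists (len 1); apply/asboolP; exists 1 => //; apply: par1.
have bP m : P m -> m <= n by case/asboolP => g Ug <-; apply: bn.
case: (ex_maxnP exP bP) => m /asboolP[a Ua <-] am; exists a; split=> // g Ug.
by apply: am; apply/asboolP; exists g.
Qed.

Lemma longest_descent U a i : longest U a -> i \in U -> N a (x i) != 1.
Proof.
move=> [Ua am] iU; apply/eqP => Na.
have /am : par x U (x i * a) by apply: parM.
by rewrite (len_powers_mul (powers_id _) Na) len_gen add1n ltnn.
Qed.

Lemma bounded_finite_par U : finite_set [set g | par x U g]%classic ->
  exists n, forall g, par x U g -> len g <= n.
Proof.
move=> /finite_seqP[s sE]; exists (\max_(g <- s) len g) => g Ug.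
have gs : [set` s]%classic g by rewrite -sE.
exact: leq_bigmax_seq.
Qed.

Section Involutive.
Variables (U : {set I}).
Hypothesis U_invol : forall i, i \in U -> x i * x i = 1.

Lemma refl_invol t : refl_of x U t -> t * t = 1.
Proof. by move=> [h [i [_ /U_invol ii ->]]]; rewrite -conjMg ii conj1g. Qed.

Lemma N_invol g t : refl_of x U t -> N g t != 1 -> N g t = t.
Proof.
by move/refl_invol/powers_invol/(_ (N_powers g t)) => [->|//]; rewrite eqxx.
Qed.

(** If [a] did not cross [t], then [t * a] would, and exchange would make [a] shorter than
    [t * a]. *)
Lemma longest_N a t : longest U a -> refl_of x U t -> N a t = t.
Proof.
move=> [Ua am] Ut; apply: N_invol => //; apply/eqP => Nat.
have tt : N t t = t by case: Ut => h [i [_ _ ->]]; apply: N_refl.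
have Nta : N (t * a) t = t.
  by rewrite N_mul tt conjg_self Nat conj1g mulg1.
have := @len_exchange (t * a) t; rewrite Nta mulKg => /(_ (refl_neq1 Ut)).
by rewrite ltnNge am //; apply: par_mul => //; apply: refl_of_par.
Qed.

Lemma longest_N_eq a g : longest U a -> par x U g ->
  (forall t, refl_of x U t -> N g t != 1) -> g = a.
Proof.
move=> al Ug Ng; apply: N_ext => t; case: (pselect (refl_of x U t)) => Ut.
  by rewrite (longest_N al Ut) N_invol // Ng.
have [Ua _] := al; by rewrite (N_par1 Ug) // (N_par1 Ua).
Qed.

Lemma longest_inv a : longest U a -> a^-1 = a.
Proof.
move=> al; have [Ua _] := al; apply: (longest_N_eq al) => [|t Ut].
  exact: par_inv.
have Ut' : refl_of x U (t ^ a^-1) by apply: refl_of_conj => //; apply: par_inv.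
by rewrite N_inv (longest_N al Ut') conjgKV invg_eq1 (refl_neq1 Ut).
Qed.

Lemma invol_word g : par x U g -> exists s : seq I,
  [/\ {subset s <= U}, \prod_(i <- s) x i = g & size s = len g].
Proof.
move=> /par_word[w [Uw <- uw]]; rewrite (len_reduced Uw uw).
exists [seq p.1 | p <- w]; split; last by rewrite size_map.
  by move=> i /mapP[p /Uw[pU _ _] ->].
rewrite /ev big_map; apply: eq_big_seq => p /Uw[pU pc p1].
by case: (powers_invol (U_invol pU) pc) p1 => -> //; rewrite eqxx.
Qed.

Lemma len_prod_gen (s : seq I) : len (\prod_(i <- s) x i) <= size s.
Proof.
elim: s => [|i s IH]; first by rewrite big_nil len_one.
by rewrite big_cons (leq_trans (len_mul _ _)) // len_gen add1n ltnS.
Qed.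

Lemma finite_bounded_par n : (forall g, par x U g -> len g <= n) ->
  finite_set [set g | par x U g]%classic.
Proof.
move=> bn; pose f (s : n.-bseq I) : D := \prod_(i <- s) x i.
have fin : finite_set (f @` setT)%classic := finite_image f finite_finset.
apply: sub_finite_set fin => g /= Ug; have [s [_ sg sl]] := invol_word Ug.
have sn : size s <= n by rewrite sl bn.
by exists (Bseq sn).
Qed.

End Involutive.

(** * One elementary step: boundedness of the component subgroup *)

Section ElementaryStep.
Variables (U : {set I}) (k : I) (v : D).
Let J := U :\ k.
Hypotheses (kU : k \in U) (vU : par x U v) (v1 : v != 1).
Hypothesis vJ : left_min J v^-1.
Hypothesis v_map : forall j, j \in J -> exists2 l, l \in U & x j ^ v^-1 = x l.

Lemma step_subset : J \subset U.
Proof. exact: subsetDl. Qed.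

Lemma step_descent : N v^-1 (x k) != 1.
Proof.
have [||i iU Ni] := @first_syllable U v^-1; first exact: par_inv.
  by rewrite invg_eq1.
case: (eqVneq i k) => [<- //|ik]; move: Ni; rewrite vJ ?eqxx //.
by apply: refl_of_gen; rewrite !inE ik.
Qed.

(** The witness equals both [x j * v^-1] and [v^-1 * x l], and [v^-1] already crosses [x k]. This
    excludes an infinite label between [j] and [k]. *)
Lemma step_two_descents j : j \in J ->
  exists g, N g (x j) != 1 /\ N g (x k) != 1.
Proof.
move=> jJ; have [l lU jl] := v_map jJ; exists (x j * v^-1).
have jk : x k != x j.
  by apply: contraTneq jJ => /x_inj <-; rewrite !inE eqxx.
have Nj : N v^-1 (x j) = 1 by apply/vJ/refl_of_gen.
split.
  by rewrite N_mul N_gen eqxx conjg_self Nj conj1g mulg1 x_neq1.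
have -> : x j * v^-1 = v^-1 * x l by rewrite conjgC jl.
rewrite N_mul N_gen -jl (inj_eq (conjg_inj _)) (negPf jk) conj1g mulg1.
exact: step_descent.
Qed.

(** Moving [h] past [v^-1] turns it into an element [h'] generated by the image of [J]. Neither [h]
    nor [h'] crosses the walls in question, so [v^-1] alone contributes on both sides. *)
Lemma N_orbit h t : par x J h -> ~ refl_of x J t ->
  N v^-1 (t ^ h) = N v^-1 t ^ h.
Proof.
move=> Jh Jt; pose Z := [set l | [exists j in J, x l == x j ^ v^-1]].
have JZ j : j \in J -> exists2 l, l \in Z & x j ^ v^-1 = x l.
  move=> jJ; have [l _ jl] := v_map jJ; exists l => //.
  by rewrite inE; apply/existsP; exists j; rewrite jJ jl eqxx.
have ZJ l : l \in Z -> exists2 j, j \in J & x l ^ v = x j.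
  rewrite inE => /existsP[j /andP[jJ /eqP ->]]; exists j => //.
  by rewrite conjgKV.
have Zh : par x Z (h ^ v^-1).
  by apply: par_conj_map Jh => j /JZ[l lZ ->]; apply: par_gen.
move: (h ^ v^-1) Zh (conjgC h v^-1) => h' Zh hE.
have : N (h * v^-1) t = N (v^-1 * h') t by rewrite hE.
rewrite !N_mul (N_par1 Jh Jt) mul1g (N_par1 Zh) => [|/(refl_of_conj_map ZJ)].
  by rewrite conj1g mulg1 => <-; rewrite conjgKV.
by rewrite conjgKV.
Qed.

Hypothesis k_invol : x k * x k = 1.

(* The coset analogue of the fact that an element with all left descents has every
   element as a prefix: multiplying [v^-1] by a suitable [h] in [par x J] supplies
   the missing descents in [J]. *)
Lemma step_prefix g : par x U g ->
  exists2 h, par x J h & prefix g (h * v^-1).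
Proof.
elim: {g}(len g).+1 {-2}g (ltnSn (len g)) => // n IH g lg Ug.
case: (eqVneq g 1) => [->|g1].
  exists 1; first exact: par1.
  by rewrite /prefix len_one invg1 !mul1g.
have [i iU Ni] := first_syllable Ug g1.
set c := N g (x i); have ic : powers (x i) c := N_powers _ _.
have lg' : len (c^-1 * g) < n by rewrite (leq_trans (len_exchange Ni)).
have Ug' : par x U (c^-1 * g).
  by apply: par_mul => //; apply/par_inv/(par_powers _ ic)/par_gen.
have [h Jh pr] := IH _ lg' Ug'.
have Ng' : N (c^-1 * g) (x i) = 1 := N_strip g i.
set d := N (h * v^-1) (x i).
have id : powers (x i) d := N_powers _ _.
have := prefix_cons (prefix_strip pr Ng') Ng' (N_strip _ i) ic.
rewrite mulVKg -/d => prg.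
(* For [i] in [J] the syllable is absorbed into [h]. For [i = k] it need not be: by [N_orbit] the
   element [h * v^-1] already crosses [x k], and as [x k] is an involution the values [c] and [d]
   coincide and cancel. *)
case: (eqVneq i k) => [ik|ik]; last first.
  have iJ : i \in J by rewrite !inE ik.
  exists (c * (d^-1 * h)); last by rewrite -!mulgA.
  have Ji := par_gen x iJ; apply: par_mul; first exact: par_powers ic.
  by apply: par_mul => //; apply: par_inv; apply: par_powers id.
have Jk : ~ refl_of x J (x k) by move/refl_of_par/par_gen_mem; rewrite !inE eqxx.
have [c1|cE] := powers_invol k_invol (eq_ind i (fun i => powers (x i) c) ic k ik).
  by rewrite -/c c1 eqxx in Ni.
have d1 : d != 1.
  rewrite /d ik N_mul (N_par1 Jh Jk) mul1g (N_orbit Jh Jk) conjgK.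
  exact: step_descent.
have [d1'|dE] := powers_invol k_invol (eq_ind i (fun i => powers (x i) d) id k ik).
  by rewrite d1' eqxx in d1.
by exists h => //; move: prg; rewrite dE cE mulVKg.
Qed.

(** [step_prefix] is applied to [t] itself: [t] crosses its own wall, hence so does [h * v^-1], and
    [N_orbit] transfers this to [v^-1]. *)
Lemma step_refl t : refl_of x U t -> ~ refl_of x J t -> N v^-1 t != 1.
Proof.
move=> Ut Jt; have [h Jh pr] := step_prefix (refl_of_par Ut).
have tt : N t t = t by case: Ut => g [i [_ _ ->]]; apply: N_refl.
have /(N_prefix pr) : N t t != 1 by rewrite tt (refl_neq1 Ut).
by rewrite N_mul (N_par1 Jh Jt) mul1g (N_orbit Jh Jt) conjgK.
Qed.

Hypothesis U_conn : forall B, B \subset U -> k \notin B -> B != finset.set0 ->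
  exists b i, [/\ b \in B, i \in U, i \notin B & ~ commute (x i) (x b)].

(* If all D_J-conjugates of [x s] commuted with [x k], a smallest [B] such that
   they all lie in [par x B] would be centralised by [U :\: B]. *)
Lemma orbit_noncommuting s : s \in J ->
  exists2 h, par x J h & ~ commute (x k) (x s ^ h).
Proof.
move=> sJ; apply: contrapT => noh.
have kcomm h : par x J h -> commute (x k) (x s ^ h).
  by move=> Jh; apply: contrapT => c; apply: noh; exists h.
pose P (B : {set I}) :=
  `[< B \subset J /\ forall h, par x J h -> par x B (x s ^ h) >].
have PJ : P J.
  by apply/asboolP; split=> // h; apply: par_conj; apply: par_gen.
case: (arg_minnP (fun B : {set I} => #|B|) PJ) => B /asboolP[BJ PB] minB.
have sB : s \in B.
  by have := PB _ (par1 _ _); rewrite conjg1 => /par_gen_mem.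
have kB : k \notin B.
  by apply/negP => /(fintype.subsetP BJ); rewrite !inE eqxx.
have [||b [u [bB uU uB]]] := U_conn _ kB.
- by apply: fintype.subset_trans BJ _; apply: step_subset.
- by apply/set0Pn; exists s.
apply; suff PBu : P (centralised B u).
  have BE : centralised B u = B.
    apply/eqP; rewrite eqEcard minB // andbT.
    by apply/fintype.subsetP => i; rewrite inE => /andP[].
  by move: bB; rewrite -BE inE => /andP[_ /eqP].
apply/asboolP; split=> [|h Jh].
  apply/fintype.subsetP => i; rewrite inE => /andP[iB _].
  exact: (fintype.subsetP BJ).
apply: par_conj_centralised => //; first exact: PB.
case: (eqVneq u k) => [->|uk].
  have -> : (x s ^ h) ^ (x k)^-1 = x s ^ h.
    by apply/commute_conj/commuteV/commute_sym/kcomm.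
  exact: PB.
rewrite -conjgM; apply: PB; apply: par_mul => //; apply: par_genV.
by rewrite !inE uk.
Qed.

Lemma step_bounded : exists n, forall g, par x U g -> len g <= n.
Proof.
have Jk : ~ par x J (x k) by move/par_gen_mem; rewrite !inE eqxx.
have JconjK h t : par x J h -> par x J (t ^ h) -> par x J t.
  by move=> Jh Jth; rewrite -(conjgK h t); apply: par_conj => //; apply: par_inv.
have [w [Uw wE _]] := par_word (par_inv vU).
have fl t : refl_of x U t -> ~ par x J t -> t \in crossed w.
  move=> Ut Jt; apply: (N_ev Uw); rewrite wE; apply: step_refl => //.
  by move/refl_of_par.
pose L := crossed w ++ [seq s ^ t | s <- crossed w, t <- crossed w].
have UL t : refl_of x U t -> t \in L.
  move=> Ut; rewrite mem_cat; case: (pselect (par x J t)) => Jt; last by rewrite fl.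
  have [m [s [Jm sJ tE]]] := refl_par Ut Jt.
  have [h Jh nc] := orbit_noncommuting sJ.
  have Jn : par x J (h^-1 * m) by apply: par_mul => //; apply: par_inv.
  have JU g : par x J g -> par x U g by apply/par_sub/step_subset.
  have Jsh : par x J (x s ^ h) by apply: par_conj => //; apply: par_gen.
  apply/orP; right; apply/allpairsP.
  (* For [n := h^-1 * m] one has [n * x k ^ n = x k * n], so conjugating the first entry by the
     second undoes [x k] and returns [x s ^ m]. The first entry lies outside [par x J], since
     otherwise [par_conj_centralised] would make [x s ^ h] commute with [x k]. *)
  exists (((x s ^ h) ^ (x k)^-1) ^ (h^-1 * m), x k ^ (h^-1 * m)) => /=.
  have sU := fintype.subsetP step_subset _ sJ.
  split.
  - apply: fl.
      apply: refl_of_conj; last exact: JU.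
      apply: refl_of_conj; last exact: par_genV.
      by apply: refl_of_conj; [apply: refl_of_gen | apply: JU].
    move/(JconjK _ _ Jn) => Jp; apply: nc; apply: par_centralised.
    apply: par_conj_centralised Jsh Jp; by rewrite !inE eqxx.
  - apply: fl; last by move/(JconjK _ _ Jn).
    by apply: refl_of_conj; [apply: refl_of_gen | apply: JU].
  - rewrite tE -!conjgM; congr (_ ^ _).
    by rewrite conjgE invgM invgK !mulgA mulgK !mulgVK mulgV mul1g.
exists (size L) => g Ug; have [w' [Uw' <- uw']] := par_word Ug.
rewrite (len_reduced Uw' uw') -size_crossed uniq_leq_size // => t tw.
exact/UL/(crossed_refl Uw').
Qed.

End ElementaryStep.

(** The product [v * b] crosses every reflection [t] of [U]: through [b] alone if [t ^ v] is a
    reflection of [U :\ k], through [v] alone otherwise. This property singles out [a], and [a] and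
    [b] are involutions. *)
Lemma step_longest U k v a b : (forall i, i \in U -> x i * x i = 1) ->
  par x U v -> left_min (U :\ k) v^-1 ->
  (forall t, refl_of x U t -> ~ refl_of x (U :\ k) t -> N v^-1 t != 1) ->
  longest U a -> longest (U :\ k) b -> v = a^-1 * b.
Proof.
move=> Ui Uv vJ vF al bl.
have JU : U :\ k \subset U by apply: subsetDl.
have Ji i : i \in U :\ k -> x i * x i = 1 by move/(fintype.subsetP JU)/Ui.
have Ub : par x U b by case: bl => Jb _; apply: par_sub Jb.
rewrite (longest_inv Ui al); apply: (mulIg b); rewrite -mulgA.
rewrite -{3}(longest_inv Ji bl) mulgV mulg1.
apply: (longest_N_eq Ui al) => [|t Ut]; first exact: par_mul.
have Utv : refl_of x U (t ^ v) by apply: refl_of_conj.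
have NvE : N v t = (N v^-1 (t ^ v))^-1 ^ v^-1.
  by have := N_inv v^-1 t; rewrite invgK conjVg.
rewrite N_mul; case: (pselect (refl_of x (U :\ k) (t ^ v))) => Jt.
  rewrite NvE vJ // invg1 conj1g mul1g (longest_N Ji bl Jt).
  by rewrite conjgK (refl_neq1 Ut).
have [Jb _] := bl; rewrite (N_par1 Jb Jt) conj1g mulg1 NvE.
by rewrite conjg_eq1 invg_eq1 vF.
Qed.

(** * Splitting a shortest conjugator into elementary steps *)

Lemma left_min_inv A B u : left_min A u ->
  (forall g, par x B g -> par x A (g ^ u^-1)) -> left_min B u^-1.
Proof.
move=> um BA; apply: left_min_inv_conj um _ => t Bt.
have := BA _ (refl_of_par Bt); case: Bt => h [i [_ _ ->]].
by rewrite -conjgM => /par_refl.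
Qed.

Definition maps_gens A B u :=
  forall i, i \in A -> exists2 j, j \in B & x i ^ u = x j.

(** The conjugate of a generator of [A] is a reflection of [B]. It is sent back to a generator by
    [u^-1], which is shortest for [B], so [refl_conj_left_min] makes it a generator. *)
Lemma left_min_maps_gens A B u : left_min A u ->
  (forall g, par x A g -> par x B (g ^ u)) ->
  (forall g, par x B g -> par x A (g ^ u^-1)) -> maps_gens A B u.
Proof.
move=> um AB BA i iA.
apply: (refl_conj_left_min (left_min_inv um BA)); last exact: conjgK.
by apply: par_refl; apply: AB; apply: par_gen.
Qed.

Section RibbonDecomposition.
Variables (Rb : {set I} -> {set I} -> D -> Prop) (cmp : {set I} -> I -> {set I}).
Hypothesis cmp_mem : forall A k, k \in cmp A k.
Hypothesis cmp_commute : forall A k i j,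
  i \in cmp A k -> j \in A -> j \notin cmp A k -> commute (x j) (x i).
Hypothesis Rb_one : forall A, Rb A A 1.
Hypothesis Rb_mul : forall A B C r s, Rb A B r -> Rb B C s -> Rb A C (s * r).
Hypothesis Rb_step : forall A B k v, k \notin A -> par x (cmp A k) v -> v != 1 ->
  left_min A v^-1 -> maps_gens (A :&: cmp A k) (cmp A k) v^-1 ->
  maps_gens A B v^-1 -> maps_gens B A v -> Rb A B v.

(** The part of [g^-1] in the component subgroup of a first letter [k] is split off as one step;
    what remains is shorter because lengths add. With [Rb] and [cmp] abstract, the induction sees
    nothing of the graph beyond commutation across components. *)
Lemma ribbon_decomposition A B g :
  left_min A g^-1 -> maps_gens A B g^-1 -> maps_gens B A g -> Rb A B g.
Proof.
elim: {g}(len g).+1 {-2}g (ltnSn (len g)) A => // n IH g lg A gm AB BA.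
case: (eqVneq g 1) => [g1|g1].
  suff -> : A = B by rewrite g1.
  apply/setP => i; apply/idP/idP => [/AB|/BA] [j jB].
    by rewrite g1 invg1 conjg1 => /x_inj ->.
  by rewrite g1 conjg1 => /x_inj ->.
have [|k _ Nk] := first_syllable (x_generate g^-1); first by rewrite invg_eq1.
have kA : k \notin A.
  by apply: contraNN Nk => kA; apply/eqP/gm/refl_of_gen.
have [h [u [Uh um gE]]] := left_decomp (cmp A k) g^-1.
have {}gE : g = u^-1 * h^-1 by rewrite -invgM -gE invgK.
have gVE : g^-1 = h * u by rewrite gE invgM !invgK.
set U := cmp A k in Uh um.
have Nh i : i \in U -> N h (x i) = N g^-1 (x i).
  by move=> iU; rewrite gVE (N_decomp um Uh (refl_of_gen x iU)).
have hm : left_min A h.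
  apply: left_minP => i iA; case: (boolP (i \in U)) => iU.
    by rewrite Nh // gm //; apply: refl_of_gen.
  by apply: (N_par1 Uh) => /refl_of_par/par_gen_mem; rewrite (negPf iU).
have h1 : h^-1 != 1.
  apply: contraNneq Nk => /(canRL invgK); rewrite invg1 => hE.
  by rewrite -Nh ?cmp_mem // hE N_one.
(* Conjugating by all of [g^-1 = h * u] ends at a generator and [u] is shortest for [U], so the
   intermediate conjugate by [h] is already a generator. *)
have U_map : maps_gens (A :&: U) U h.
  move=> i; rewrite inE => /andP[iA iU]; have [j _ ij] := AB i iA.
  apply: (@refl_conj_left_min U u _ j um); last by rewrite -conjgM -gVE.
  by apply: refl_of_conj => //; apply: refl_of_gen.
have A_map i : i \in A -> exists l, x i ^ h = x l.
  move=> iA; case: (boolP (i \in U)) => iU.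
    by have [|l _ ->] := U_map i; [rewrite inE iA | exists l].
  exists i; apply: commute_conj; apply: (par_commute _ Uh) => j jU.
  exact: (@cmp_commute A k).
pose C := [set l | [exists i in A, x l == x i ^ h]].
have AC : maps_gens A C h.
  move=> i iA; have [l il] := A_map i iA; exists l => //.
  by rewrite inE; apply/existsP; exists i; rewrite iA il eqxx.
have CE l : l \in C -> exists2 i, i \in A & x l = x i ^ h.
  by rewrite inE => /existsP[i /andP[iA /eqP li]]; exists i.
rewrite gE; apply: (@Rb_mul A C B).
  apply: (@Rb_step A C k) => //; rewrite ?invgK //; first exact: par_inv.
  by move=> l /CE[i iA ->]; exists i; rewrite ?conjgK.
apply: IH; rewrite ?invgK.
- rewrite ltnS in lg; apply: leq_trans lg; rewrite gE (len_left_decomp um (par_inv Uh)).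
  by rewrite -[X in X < _]addn0 ltn_add2l lt0n; apply: contraNneq h1 => /len_eq0 ->.
- apply: left_minP => l /CE[i iA ->].
  have : N g^-1 (x i) = 1 by apply/gm/refl_of_gen.
  rewrite gVE N_mul hm ?mul1g; last exact: refl_of_gen.
  by move/eqP; rewrite conjg_eq1 => /eqP.
- move=> l /CE[i iA ->]; have [j jB ij] := AB i iA.
  by exists j; rewrite // -conjgM -gVE.
move=> j /[dup] jB /BA[i iA ji]; have [l lC il] := AC i iA.
by exists l; rewrite // -il -ji -conjgM gE mulgVK.
Qed.

End RibbonDecomposition.

End Cocycle.

(** * A representation by pseudo-reflections *)

Section Representation.
Import GRing.Theory Num.Theory.
Local Open Scope ring_scope.
Variable G : dyer_graph.
Implicit Types (u v t : G) (f : G -> {poly algC}) (Q : algC).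

Definition zeta n : algC :=
  if n is m.+1 then sval (C_prim_root_exists (ltn0Sn m)) else 1.

Lemma zetaP n : (0 < n)%N -> n.-primitive_root (zeta n).
Proof. by case: n => // n _; rewrite /zeta; case: C_prim_root_exists. Qed.

(** For infinite order any number that is not a root of unity serves; 2 is one. *)
Definition mult v : algC := if vlab v is Some n then zeta n else 2.

Lemma expr2_eq1 n : (2 : algC) ^+ n = 1 -> n = 0%N.
Proof.
by rewrite -natrX => /eqP; rewrite pnatr_eq1; case: n => // n; rewrite expnS muln_eq1.
Qed.

Lemma mult_neq0 v : mult v != 0.
Proof.
rewrite /mult; case E : (vlab v) => [n|]; last by rewrite ?subr_eq0 ?pnatr_eq0 ?pnatr_eq1.
have n0 := ltnW (vlab_ge2 E).
by rewrite (prim_root_eq0 (zetaP n0)) -lt0n.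
Qed.

Lemma mult_neq1 v : mult v - 1 != 0.
Proof.
rewrite subr_eq0 /mult; case E : (vlab v) => [n|]; last by rewrite ?subr_eq0 ?pnatr_eq0 ?pnatr_eq1.
have n2 := vlab_ge2 E.
by rewrite -[zeta n]expr1 -(prim_order_dvd (zetaP (ltnW n2))) gtnNdvd.
Qed.

Lemma mult_order2 v : vlab v = Some 2%N -> mult v = -1.
Proof.
move=> E; apply/eqP; have := mult_neq1 v.
have : mult v ^+ 2 = 1 by rewrite /mult E prim_expr_order //; apply: zetaP.
by move/eqP; rewrite sqrf_eq1 subr_eq0 => /orP[->|].
Qed.

(** With a primitive root of order [k.*2], the sum of the root and its inverse plays the role of
    twice the cosine of pi over [k] in the geometric representation of a Coxeter group. For an
    infinite label, ['X] lets degrees record alternation. *)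
Definition coef u v : {poly algC} :=
  if edge u v then
    if elab u v is Some k then (zeta k.*2 + (zeta k.*2)^-1)%:P else 'X
  else 0.

Lemma coef_sym u v : coef u v = coef v u.
Proof.
by rewrite /coef edge_sym; case E : (edge v u); rewrite // (elab_sym E).
Qed.

(* A pseudo-reflection of multiplier [Q]; as [mult v != 1], the multiplicative
   group of all [Q] acts, and [mult v] has the order of [v]. *)
Definition pseudo_refl v Q f : G -> {poly algC} := fun t =>
  if t == v then Q *: f v else f t + coef v t * (((Q - 1) / (mult v - 1)) *: f v).

Lemma refl_mul v Q Q' f : pseudo_refl v Q (pseudo_refl v Q' f) = pseudo_refl v (Q * Q') f.
Proof.
apply/funext => t; rewrite /pseudo_refl eqxx; case: (t == v); first by rewrite scalerA.
rewrite -addrA -mulrDr scalerA -scalerDl; congr (_ + _ * (_ *: _)).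
rewrite mulrAC -mulrDl; congr (_ / _); by rewrite mulrBl mul1r addrC addrA subrK.
Qed.

Lemma refl_one v f : pseudo_refl v 1 f = f.
Proof.
apply/funext => t; rewrite /pseudo_refl; case: eqP => [->|_]; first by rewrite scale1r.
by rewrite subrr mul0r scale0r mulr0 addr0.
Qed.

Lemma refl_commute u v Q Q' f : u != v -> ~~ edge u v ->
  pseudo_refl u Q (pseudo_refl v Q' f) = pseudo_refl v Q' (pseudo_refl u Q f).
Proof.
move=> uv nuv; have cuv : coef u v = 0 by rewrite /coef (negPf nuv).
have cvu : coef v u = 0 by rewrite coef_sym.
have vu : v != u by rewrite eq_sym.
apply/funext => t; rewrite /pseudo_refl (negPf uv) (negPf vu) cuv cvu.
rewrite !mul0r !addr0; case: (eqVneq t u) => [->|tu].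
  by rewrite (negPf uv) cvu mul0r addr0.
case: (eqVneq t v) => [->|_]; last by rewrite addrAC.
by rewrite cuv mul0r addr0.
Qed.

Definition letter_act (p : G * bool) :=
  pseudo_refl p.1 (if p.2 then (mult p.1)^-1 else mult p.1).

Definition word_act (w : word G) f := foldr letter_act f w.

Lemma word_act_cat a b f : word_act (a ++ b) f = word_act a (word_act b f).
Proof. by rewrite /word_act foldr_cat. Qed.

Lemma word_act_nseq n v f :
  word_act (nseq n (v, false)) f = pseudo_refl v (mult v ^+ n) f.
Proof.
elim: n => [|n IH] /=; first by rewrite refl_one.
by rewrite IH /letter_act refl_mul exprS.
Qed.

Lemma refl2 v f t : vlab v = Some 2%N ->
  pseudo_refl v (mult v) f t = if t == v then - f v else f t + coef v t * f v.
Proof.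
move=> v2; rewrite /pseudo_refl divff ?mult_neq1 // scale1r.
by rewrite mult_order2 // scaleN1r.
Qed.

Lemma alternatingS u v j :
  alternating u v j.+1 = (u, false) :: alternating v u j.
Proof.
rewrite /alternating /mkseq /= -[1%N]addn0 iotaDl -map_comp; congr (_ :: _).
by apply: eq_map => i /=; rewrite if_neg.
Qed.

Lemma affine_inj (y y' : algC) (a b a' b' : {poly algC}) : y - y' != 0 ->
  a + y *: b = a' + y *: b' -> a + y' *: b = a' + y' *: b' -> b = b'.
Proof.
move=> yy e1 e2; apply: (scalerI yy); rewrite !scalerBl.
have -> : y *: b - y' *: b = (a + y *: b) - (a + y' *: b) by ring.
by rewrite e1 e2; ring.
Qed.

Lemma sub_inv_neq0 (y : algC) : y != 0 -> y ^+ 2 != 1 -> y - y^-1 != 0.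
Proof.
move=> y0; apply: contra; rewrite subr_eq0 => /eqP yE.
by rewrite expr2 {2}yE mulfV.
Qed.

(** This discriminant equals minus the square of [y - y^-1]. It is the coefficient of [f t] in the
    dihedral invariant [psi], which can therefore recover [f t]. *)
Lemma disc_neq0 (y : algC) : y != 0 -> y ^+ 2 != 1 ->
  4 - (y + y^-1)%:P ^+ 2 != 0 :> {poly algC}.
Proof.
move=> y0 y2; have -> : 4 - (y + y^-1)%:P ^+ 2 = (- (y - y^-1) ^+ 2)%:P.
  rewrite rmorphN rmorphXn rmorphB polyCD /=.
  have yV : y%:P * y^-1%:P = 1 :> {poly algC} by rewrite -polyCM mulfV.
  set Y := y%:P in yV *; set W := y^-1%:P in yV *.
  transitivity (4 * (Y * W) - (Y + W) ^+ 2); first by rewrite yV mulr1.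
  by ring.
by rewrite polyC_eq0 oppr_eq0 expf_eq0 /= sub_inv_neq0.
Qed.

(** * The braid relation of an edge with finite label *)

Section Braid.
Variables (u v : G) (k : nat).
Hypotheses (uv : u != v) (euv : edge u v) (luv : elab u v = Some k).
Let z := zeta k.*2.

(** A vertex label other than 2 forces the label infinity on every edge at that vertex. *)
Lemma braid_order2 : vlab u = Some 2%N /\ vlab v = Some 2%N.
Proof.
suff H (a b : G) : edge a b -> elab a b = Some k -> vlab b = Some 2%N.
  by split; [apply: (H v); rewrite -?(elab_sym euv) // edge_sym | apply: (H u)].
move=> eab lab; have := @dyer_cond _ _ _ eab; rewrite lab.
case E : (vlab b) => [n|] h; last by have := h isT.
have := vlab_ge2 E; rewrite leq_eqVlt => /orP[/eqP <- //|n3].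
by have := h n3.
Qed.

Lemma braid_gt2 : (2 < k)%N. Proof. exact: elab_gt2 euv luv. Qed.

Lemma braid_zeta : k.*2.-primitive_root z.
Proof.
by apply: zetaP; rewrite double_gt0; apply: leq_trans braid_gt2.
Qed.

Lemma braid_zeta_neq0 : z != 0.
Proof. by rewrite (prim_root_eq0 braid_zeta) double_eq0 -lt0n (leq_trans _ braid_gt2). Qed.

Lemma braid_zeta2 : z ^+ 2 != 1.
Proof.
rewrite -(prim_order_dvd braid_zeta) gtnNdvd //.
by have := braid_gt2; case: (k) => [|[]].
Qed.

Lemma braid_zeta4 : z ^+ 4 != 1.
Proof.
rewrite -(prim_order_dvd braid_zeta) gtnNdvd //.
by have := braid_gt2; case: (k) => [|[|[]]].
Qed.

Let c : algC := z + z^-1.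

Lemma braid_coef : coef u v = c%:P /\ coef v u = c%:P.
Proof. by split; rewrite ?[coef v u]coef_sym /coef euv luv. Qed.

Lemma braid_coef_neq0 : c != 0.
Proof.
apply: contraNneq braid_zeta4 => /(congr1 ( *%R z)).
rewrite mulr0 mulrDr mulfV ?braid_zeta_neq0 // -expr2 => /eqP.
by rewrite addr_eq0 (exprM z 2 2) => /eqP ->; rewrite sqrrN expr1n.
Qed.

(* [phi] and [psi] below are the eigenfunctionals and the invariants of the
   dihedral group generated by the two pseudo-reflections; they separate points
   because [c] is neither 2 nor -2. *)
Let phi (y : algC) f := f u + y *: f v.

Lemma phi_refl y f : c = y + y^-1 -> y != 0 ->
  phi y (pseudo_refl u (mult u) f) = y ^+ 2 *: phi y^-1 f /\
  phi y (pseudo_refl v (mult v) f) = phi y^-1 f.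
Proof.
move=> cy y0; have [u2 v2] := braid_order2; have [cuv cvu] := braid_coef.
have vu : v != u by rewrite eq_sym.
rewrite /phi !refl2 // !eqxx (negPf uv) (negPf vu) cuv cvu cy.
have yV : y%:P * y^-1%:P = 1 :> {poly algC} by rewrite -polyCM mulfV.
rewrite -!mul_polyC rmorphXn polyCD /=.
set Y := y%:P in yV *; set W := y^-1%:P in yV *; split; last by ring.
transitivity (Y ^+ 2 * f u + Y * f v + (Y * W - 1) * f u); first by ring.
transitivity (Y ^+ 2 * f u + Y * W * Y * f v); last by ring.
by rewrite yV; ring.
Qed.

(** Each letter exchanges [y] and [y^-1], and only the letters [u] produce a scalar. In an
    alternating word they always meet the same one of the two, so the exponents add up instead of
    cancelling. *)
Lemma phi_alternating y j f : c = y + y^-1 -> y != 0 ->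
  phi y (word_act (alternating u v j) f) =
    y ^+ (uphalf j).*2 *: phi (if odd j then y^-1 else y) f /\
  phi y (word_act (alternating v u j) f) =
    y^-1 ^+ (j./2).*2 *: phi (if odd j then y^-1 else y) f.
Proof.
elim: j y => [|j IH] y cy y0; first by rewrite !expr0 !scale1r.
have cy' : c = y^-1 + y^-1^-1 by rewrite invrK addrC.
have y0' : y^-1 != 0 by rewrite invr_eq0.
have [IHv IHu] := IH _ cy' y0'.
rewrite !alternatingS /= /letter_act /=.
have [-> _] := phi_refl (word_act (alternating v u j) f) cy y0.
have [_ ->] := phi_refl (word_act (alternating u v j) f) cy y0.
rewrite IHu IHv invrK scalerA -exprD; case: (odd j); split=> //.
Qed.

Let psi t f := (4 - c%:P ^+ 2) * f t + (2 * coef u t + c%:P * coef v t) * f u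
  + (2 * coef v t + c%:P * coef u t) * f v.

Lemma psi_refl t f : t != u -> t != v ->
  psi t (pseudo_refl u (mult u) f) = psi t f /\ psi t (pseudo_refl v (mult v) f) = psi t f.
Proof.
move=> tu tv; have [u2 v2] := braid_order2; have [cuv cvu] := braid_coef.
have vu : v != u by rewrite eq_sym.
rewrite /psi !refl2 // !eqxx (negPf uv) (negPf vu) (negPf tu) (negPf tv) cuv cvu.
by split; ring.
Qed.

Lemma psi_alternating t j f : t != u -> t != v ->
  psi t (word_act (alternating u v j) f) = psi t f /\
  psi t (word_act (alternating v u j) f) = psi t f.
Proof.
move=> tu tv; elim: j => [|j [IHu IHv]] //; rewrite !alternatingS /= /letter_act /=.
have [-> _] := psi_refl (word_act (alternating v u j) f) tu tv.
by have [_ ->] := psi_refl (word_act (alternating u v j) f) tu tv.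
Qed.

Lemma braid_act f :
  word_act (alternating u v k) f = word_act (alternating v u k) f.
Proof.
set g := LHS; set g' := RHS.
have z0 := braid_zeta_neq0; have z2 := braid_zeta2.
(* The two words scale [phi] by powers of [y] whose exponents differ by [k.*2], which the root of
   unity kills. *)
have phiE y : c = y + y^-1 -> y != 0 -> y ^+ k.*2 = 1 -> phi y g = phi y g'.
  move=> cy y0 yk; rewrite /g /g'; have [-> ->] := phi_alternating k f cy y0.
  congr (_ *: _); apply: (mulIf (expf_neq0 (k./2).*2 y0)).
  rewrite exprVn mulVf ?expf_neq0 // -exprD -doubleD.
  have -> : (uphalf k + k./2 = k)%N by rewrite uphalf_half -addnA addnn odd_double_half.
  by [].
have e1 := phiE z erefl z0 (prim_expr_order braid_zeta).
have e2 : phi z^-1 g = phi z^-1 g'.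
  have cz : c = z^-1 + z^-1^-1 by rewrite invrK addrC.
  have z0' : z^-1 != 0 by rewrite invr_eq0.
  by apply: (phiE _ cz z0'); rewrite exprVn (prim_expr_order braid_zeta) invr1.
have gv : g v = g' v.
  exact: (affine_inj (sub_inv_neq0 z0 z2) e1 e2).
have gu : g u = g' u.
  by apply: (addIr (z *: g' v)); rewrite -{1}gv; exact: e1.
apply/funext => t; case: (eqVneq t u) => [-> //|tu]; case: (eqVneq t v) => [-> //|tv].
have d0 : 4 - c%:P ^+ 2 != 0 :> {poly algC} by exact: disc_neq0.
apply: (mulfI d0); have [gt g't] := psi_alternating k f tu tv.
apply: (addIr ((2 * coef u t + c%:P * coef v t) * g' u)).
apply: (addIr ((2 * coef v t + c%:P * coef u t) * g' v)).
by rewrite -{1}gu -{1}gv; exact: (etrans gt (esym g't)).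
Qed.

End Braid.

(** * Detecting edges, infinite labels and orders *)

Lemma coef_neq0 u v : edge u v -> coef u v != 0.
Proof.
move=> euv; case E : (elab u v) => [k|]; last by rewrite /coef euv E polyX_eq0.
by have [-> _] := braid_coef euv E; rewrite polyC_eq0 (braid_coef_neq0 euv E).
Qed.

Lemma refl_gen_commute u v : edge u v ->
  exists f, pseudo_refl u (mult u) (pseudo_refl v (mult v) f) <>
    pseudo_refl v (mult v) (pseudo_refl u (mult u) f).
Proof.
move=> euv; have uv : u != v by apply: contraTneq euv => ->; rewrite edge_irr.
have vu : v != u by rewrite eq_sym.
(* Evaluated at [u], the two composites give [mult u] times [coef v u] and [coef v u] itself. *)
exists (fun t => if t == v then 1 else 0) => /(congr1 (fun g => g u)).
rewrite /pseudo_refl !eqxx (negPf uv) (negPf vu) !divff ?mult_neq1 // !scale1r.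
rewrite scaler0 mulr0 addr0 !add0r mulr1 => /eqP; rewrite -subr_eq0.
rewrite -{2}[coef v u]scale1r -scalerBl scaler_eq0 (negPf (mult_neq1 u)) /=.
by rewrite coef_sym (negPf (coef_neq0 euv)).
Qed.

(** At [v] a nonzero multiple of ['X * f u] is added, of larger degree than [f v]; at [u] the value
    is merely rescaled. *)
Lemma refl_cone u v Q f : edge u v -> elab u v = None -> Q != 1 ->
  f u != 0 -> (size (f v) <= size (f u))%N ->
  (size (pseudo_refl u Q f u) < size (pseudo_refl u Q f v))%N.
Proof.
move=> euv luv Q1 fu le; have vu : v != u.
  by apply: contraTneq euv => ->; rewrite edge_irr.
have cE : coef u v = 'X by rewrite /coef euv luv.
have k0 : (Q - 1) / (mult u - 1) != 0.
  by rewrite mulf_neq0 ?invr_eq0 ?mult_neq1 // subr_eq0.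
have sX : size (coef u v * (((Q - 1) / (mult u - 1)) *: f u)) = (size (f u)).+1.
  by rewrite cE mulrC size_mulX ?scaler_eq0 ?negb_or ?k0 // size_scale.
rewrite /pseudo_refl eqxx (negPf vu) addrC size_polyDl sX ?ltnS //.
exact: size_scale_leq.
Qed.

Lemma dyer_rel_act a b f : dyer_rel a b -> word_act a f = word_act b f.
Proof.
case=> [v n vn|u v k uv].
  rewrite word_act_nseq /mult vn prim_expr_order ?refl_one //.
  by apply: zetaP; apply: ltnW (vlab_ge2 vn).
rewrite /elab_ext; case: (boolP (edge u v)) => [euv luv|nuv [<-]].
  exact: braid_act.
by rewrite /= /letter_act refl_commute.
Qed.

Lemma pres_act a b f : pres_eq (@dyer_rel G) a b -> word_act a f = word_act b f.
Proof.
move=> ab; elim: ab f => {a b}.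
- by move=> a b ab f; apply: dyer_rel_act.
- move=> v s f; rewrite /= /letter_act /= refl_mul -[RHS](refl_one v).
  by case: s => /=; rewrite ?mulfV ?mulVf ?mult_neq0.
- by [].
- by move=> a b _ IH f; rewrite IH.
- by move=> a b c _ IH1 _ IH2 f; rewrite IH1.
- by move=> a b c d _ IH1 _ IH2 f; rewrite !word_act_cat IH2 IH1.
Qed.

Lemma word_act_nseqV n v f :
  word_act (nseq n (v, true)) f = pseudo_refl v (mult v ^- n) f.
Proof.
elim: n => [|n IH] /=; first by rewrite invr1 refl_one.
by rewrite IH /letter_act refl_mul /= exprS invfM.
Qed.

Lemma refl_eq_id v Q : (forall f, pseudo_refl v Q f = f) -> Q = 1.
Proof.
move=> /(_ (fun=> 1)) /(congr1 (fun g => g v)); rewrite /pseudo_refl eqxx => /eqP.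
by rewrite -subr_eq0 -{2}[1]scale1r -scalerBl scaler_eq0 oner_eq0 orbF subr_eq0 => /eqP.
Qed.

Lemma mult_expr_eq1 v n :
  (mult v ^+ n == 1) = if vlab v is Some m then (m %| n)%N else n == 0%N.
Proof.
rewrite /mult; case E : (vlab v) => [m|].
  by rewrite -(prim_order_dvd (zetaP (ltnW (vlab_ge2 E)))).
by apply/eqP/eqP => [/expr2_eq1//|->].
Qed.

End Representation.

(** * The cocycle of a Dyer system *)

Section System.
Variables (D : groupType) (X : set D) (S : dyer_system X).
Let G := sys_graph S.
Let x (v : G) : D := std v.
Implicit Types (g h t : D) (u v : G) (w a b : word G).

Definition word_class w : dyer_group G := \pi_(presented (@dyer_rel G))%qT w.
Definition letter (p : G * bool) : D := if p.2 then (x p.1)^-1 else x p.1.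
Definition eval w : D := \prod_(p <- w) letter p.

Lemma eval_nil : eval [::] = 1.
Proof. by rewrite /eval big_nil. Qed.

Lemma eval_cons p w : eval (p :: w) = letter p * eval w.
Proof. by rewrite /eval big_cons. Qed.

Lemma eval_cat a b : eval (a ++ b) = eval a * eval b.
Proof. by rewrite /eval big_cat. Qed.

Lemma word_class_cat a b : word_class (a ++ b) = word_class a * word_class b.
Proof. by rewrite /word_class -pres_mulE. Qed.

Lemma word_class_nil : word_class [::] = 1.
Proof. by []. Qed.

Lemma sys_iso_one : sys_iso (1 : dyer_group G) = 1 :> D.
Proof.
by apply: (mulgI (sys_iso (1 : dyer_group G))); rewrite -sys_iso_morph !mulg1.
Qed.

Lemma word_class_iso w : sys_iso (word_class w) = eval w.
Proof.
elim: w => [|[v s] w IH]; first by rewrite eval_nil -sys_iso_one.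
rewrite -cat1s word_class_cat sys_iso_morph IH eval_cat /eval big_seq1.
congr (_ * _); rewrite /letter /=; case: s => //=.
apply: (mulgI (x v)); rewrite mulgV -sys_iso_one /x /std.
rewrite -sys_iso_morph -word_class_nil; congr (sys_iso _).
rewrite -[dyer_gen v]/(word_class [:: (v, false)]) -word_class_cat.
exact/pres_piP/pres_cancel.
Qed.

Lemma eval_pres_eq a b : eval a = eval b <-> pres_eq (@dyer_rel G) a b.
Proof.
rewrite -!word_class_iso; split=> [/(bij_inj (sys_iso_bij S))|ab].
  by move/pres_piP.
by congr (sys_iso _); apply/pres_piP.
Qed.

Lemma eval_surj g : exists w, eval w = g.
Proof.
have [f _ fK] := sys_iso_bij S; have [w fg] := presentedP (f g).
by exists w; rewrite -word_class_iso /word_class -fg fK.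
Qed.

Definition word_of g := sval (cid (eval_surj g)).

Lemma word_ofK g : eval (word_of g) = g.
Proof. by rewrite /word_of; case: cid. Qed.

Lemma std_inj : injective x.
Proof.
by have [_ inj _] := sys_iso_gen S; move=> u v uv; apply: inj; rewrite ?inE.
Qed.

Lemma std_expg v n : vlab v = Some n -> x v ^+ n = 1.
Proof.
move=> vn; rewrite -eval_nil.
have -> : x v ^+ n = eval (nseq n (v, false)).
  elim: n {vn} => [|n IH]; first by rewrite eval_nil.
  by rewrite expgS IH /= eval_cons.
by apply/eval_pres_eq/pres_rel/dyer_power.
Qed.

Lemma std_commute u v : ~~ edge u v -> commute (x u) (x v).
Proof.
case: (eqVneq u v) => [-> _|uv nuv]; first exact: commute_refl.
have /eval_pres_eq : pres_eq (@dyer_rel G) (alternating u v 2) (alternating v u 2).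
  by apply/pres_rel/dyer_braid; rewrite // /elab_ext (negPf nuv).
by rewrite /eval /alternating /= !big_cons big_nil !mulg1.
Qed.

(** * The cocycle on words and its invariance under the relations *)

Fixpoint cross w t : D :=
  if w is p :: w' then
    (if t == x p.1 then letter p else 1) * cross w' (t ^ letter p) ^ (letter p)^-1
  else 1.

Lemma cross_cat a b t : cross (a ++ b) t = cross a t * cross b (t ^ eval a) ^ (eval a)^-1.
Proof.
elim: a t => [|p a IH] t /=; first by rewrite eval_nil invg1 !conjg1 mul1g.
by rewrite IH eval_cons conjMg mulgA invgM !conjgM.
Qed.

Lemma conj_letter t p : (t ^ letter p == x p.1) = (t == x p.1).
Proof.
by rewrite /letter; case: p.2; rewrite ?conjgV_eq_self ?conjg_eq_self.
Qed.

Lemma cross_nseq n v t :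
  cross (nseq n (v, false)) t = if t == x v then x v ^+ n else 1.
Proof.
elim: n t => [|n IH] t /=; first by rewrite if_same.
rewrite IH /letter /= conjg_eq_self; case: eqP => [_|_]; last first.
  by rewrite conj1g mulg1.
rewrite expgS; congr (_ * _); apply/commute_conj/commuteV.
exact/commute_sym/commuteX.
Qed.

(** Both sides of a braid relation are positive words, for which [cross] only counts occurrences of
    a wall; invariance is then a matter of permuting this list. *)
Fixpoint walls (s : seq G) : seq D :=
  if s is v :: s' then x v :: [seq t ^ (x v)^-1 | t <- walls s'] else [::].

Lemma cross_walls (s : seq G) t :
  cross [seq (v, false) | v <- s] t = t ^+ count_mem t (walls s).
Proof.
elim: s t => //= v s IH t; rewrite IH /letter /= expgnDr -conjXg conjgK.
rewrite eq_sym count_map; congr (_ * _).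
  by case: eqP => [->|_]; rewrite ?expg1.
congr (_ ^+ _); apply: eq_count => r /=.
by rewrite (can2_eq (conjgKV _) (conjgK _)).
Qed.

Definition alt_seq u v k : seq G := mkseq (fun i => if odd i then v else u) k.

Lemma alternatingE u v k : alternating u v k = [seq (r, false) | r <- alt_seq u v k].
Proof. by rewrite /alternating /alt_seq /mkseq -map_comp. Qed.

Lemma mkseqS (T : Type) (f : nat -> T) n :
  mkseq f n.+1 = f 0%N :: mkseq (fun i => f i.+1) n.
Proof. by rewrite /mkseq /= -[1%N]addn0 iotaDl -map_comp. Qed.

Lemma alt_seqS u v k : alt_seq u v k.+1 = u :: alt_seq v u k.
Proof.
rewrite /alt_seq mkseqS; congr (_ :: _); apply: eq_map => i /=.
by rewrite if_neg.
Qed.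

Section BraidWalls.
Variables (u v : G).
Hypotheses (uu : x u * x u = 1) (vv : x v * x v = 1).

Lemma expgMS g h n : (g * h) ^+ n.+1 = g * (h * g) ^+ n * h.
Proof.
elim: n => [|n IH]; first by rewrite expg1 expg0 mulg1.
by rewrite expgS IH [in RHS]expgS !mulgA.
Qed.

Lemma walls_alt_seq k :
  walls (alt_seq u v k) = mkseq (fun j => (x u * x v) ^+ j * x u) k /\
  walls (alt_seq v u k) = mkseq (fun j => (x v * x u) ^+ j * x v) k.
Proof.
have step (a b : G) n : x a * x a = 1 ->
    [seq t ^ (x a)^-1 | t <- mkseq (fun j => (x b * x a) ^+ j * x b) n] =
    mkseq (fun j => (x a * x b) ^+ j.+1 * x a) n.
  move=> /mulg1_eq aV; rewrite /mkseq -map_comp; apply: eq_map => j /=.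
  by rewrite conjgE invgK aV expgMS !mulgA.
elim: k => [|k [IHu IHv]] //; rewrite !alt_seqS /= IHu IHv !step // !mkseqS.
by rewrite !expg0 !mul1g.
Qed.

Lemma eval_alternating k :
  eval (alternating u v k) * (eval (alternating v u k))^-1 = (x u * x v) ^+ k /\
  eval (alternating v u k) * (eval (alternating u v k))^-1 = (x v * x u) ^+ k.
Proof.
elim: k => [|k [IHu IHv]]; first by rewrite /= eval_nil invg1 mulg1.
rewrite !alternatingS !eval_cons !invgM /letter /=.
rewrite -!mulgA (mulgA (eval (alternating v u k))) IHv.
rewrite (mulgA (eval (alternating u v k))) IHu !expgMS.
by rewrite (mulg1_eq uu) (mulg1_eq vv) !mulgA.
Qed.

(** The hypothesis says that [x u * x v] has [k]-th power 1; reading the walls of one word backwards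
    then gives the walls of the other. *)
Lemma perm_walls k : eval (alternating u v k) = eval (alternating v u k) ->
  perm_eq (walls (alt_seq u v k)) (walls (alt_seq v u k)).
Proof.
move=> e; have [-> ->] := walls_alt_seq k.
have [uvk _] := eval_alternating k; rewrite e mulgV in uvk.
have vuE : x v * x u = (x u * x v)^-1.
  by rewrite invgM (mulg1_eq uu) (mulg1_eq vv).
rewrite -(perm_rev (mkseq _ k)) (_ : rev _ = mkseq (fun j => (x v * x u) ^+ j * x v) k) //.
apply: (@eq_from_nth _ 1); rewrite ?size_rev !size_mkseq // => i ik.
rewrite nth_rev ?size_mkseq // !nth_mkseq ?ltn_subrL ?(leq_trans _ ik) //.
apply: (mulIg (x v)); rewrite -!mulgA vv mulg1 -expgSr subnSK //.
by rewrite expgnFr ?(ltnW ik) // -uvk mul1g vuE expVgn.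
Qed.

End BraidWalls.

Lemma cross_rel a b t : dyer_rel a b -> cross a t = cross b t.
Proof.
case=> [v n vn|u v k uv ek].
  by rewrite cross_nseq (std_expg vn) if_same.
have e : eval (alternating u v k) = eval (alternating v u k).
  by apply/eval_pres_eq/pres_rel/dyer_braid.
rewrite !alternatingE !cross_walls; congr (_ ^+ _); apply/permP.
move: ek; rewrite /elab_ext; case: (boolP (edge u v)) => [euv luv|nuv [<-]].
  have [u2 v2] := braid_order2 euv luv.
  by apply: perm_walls; rewrite // -expg2 std_expg.
have uvC := std_commute nuv.
rewrite /alt_seq /= (commute_conj (commuteV (commute_sym uvC))).
rewrite (commute_conj (commuteV uvC)).
by apply/permP => r /=; rewrite addnCA.
Qed.

Lemma cross_pres a b t : pres_eq (@dyer_rel G) a b -> cross a t = cross b t.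
Proof.
move=> ab; elim: ab t => {a b}.
- by move=> a b ab t; apply: cross_rel.
- move=> v s t; rewrite /= (conj_letter t (v, s)); case: (t =P x v) => [_|_].
  by case: s; rewrite /letter /= conj1g mulg1 ?invgK conjg_self ?mulgV ?mulVg.
  by rewrite !mul1g !conj1g.
- by [].
- by move=> a b _ IH t; rewrite IH.
- by move=> a b c _ IH1 _ IH2 t; rewrite IH1.
- move=> a b c d /eval_pres_eq ab IH1 _ IH2 t.
  by rewrite !cross_cat IH1 IH2 ab.
Qed.

Definition Ncross g t := cross (word_of g) t.

Lemma Ncross_eval w t : Ncross (eval w) t = cross w t.
Proof. by apply/cross_pres/eval_pres_eq/word_ofK. Qed.

Lemma Ncross_mul g h t :
  Ncross (g * h) t = Ncross g t * Ncross h (t ^ g) ^ g^-1.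
Proof.
by rewrite -{1}(word_ofK g) -{1}(word_ofK h) -eval_cat Ncross_eval cross_cat word_ofK.
Qed.

Lemma Ncross_gen v t : Ncross (x v) t = if t == x v then x v else 1.
Proof.
have {1}-> : x v = eval [:: (v, false)] by rewrite eval_cons eval_nil mulg1.
by rewrite Ncross_eval /= conj1g mulg1.
Qed.

Lemma std_generate g : par x [set: G] g.
Proof.
rewrite -(word_ofK g); elim: (word_of g) => [|[v s] w IH].
  by rewrite eval_nil; apply: par1.
by rewrite eval_cons /letter /=; case: s; [apply: parV|apply: parM].
Qed.

(** * The representation on the group and exact orders of generators *)

Definition act g (f : G -> {poly algC}) := word_act (word_of g) f.

Lemma act_eval w f : act (eval w) f = word_act w f.
Proof. by apply/pres_act/eval_pres_eq/word_ofK. Qed.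

Lemma act_mul g h f : act (g * h) f = act g (act h f).
Proof.
by rewrite -{1}(word_ofK g) -{1}(word_ofK h) -eval_cat act_eval word_act_cat.
Qed.

Lemma act_one f : act 1 f = f.
Proof. by rewrite -eval_nil act_eval. Qed.

Lemma eval_nseq v (s : bool) n :
  eval (nseq n (v, s)) = if s then x v ^- n else x v ^+ n.
Proof.
elim: n => [|n IH] /=; first by rewrite eval_nil expg0 invg1 if_same.
by rewrite eval_cons IH /letter; case: s {IH} => /=; rewrite ?expgS // -expgS expgSr invgM.
Qed.

Lemma act_expg v n f : act (x v ^+ n) f = pseudo_refl v (mult v ^+ n)%R f.
Proof. by rewrite -(eval_nseq v false) act_eval word_act_nseq. Qed.

Lemma act_expgV v n f : act (x v ^- n) f = pseudo_refl v (mult v ^- n)%R f.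
Proof. by rewrite -(eval_nseq v true) act_eval word_act_nseqV. Qed.

Lemma act_gen v f : act (x v) f = pseudo_refl v (mult v) f.
Proof. by have := act_expg v 1 f; rewrite expg1. Qed.

(** The relations give one direction; for the other, the order is read off from the multiplier of
    the pseudo-reflection. *)
Lemma std_expg_eq1 v n :
  (x v ^+ n == 1) = if vlab v is Some m then (m %| n)%N else n == 0%N.
Proof.
rewrite -mult_expr_eq1; apply/eqP/eqP => [xn|].
  by apply: (@refl_eq_id _ v) => f; rewrite -act_expg xn act_one.
move/eqP; rewrite mult_expr_eq1; case E : (vlab v) => [m|] => [/dvdnP[q ->]|/eqP->] //.
by rewrite mulnC expgnA std_expg // expg1n.
Qed.

Lemma std_neq1 v : x v != 1.
Proof.
rewrite -[x v]expg1 std_expg_eq1; case E : (vlab v) => [m|//].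
by rewrite gtnNdvd // (vlab_ge2 E).
Qed.

Lemma elt_order_std v : elt_order (x v) = vlab v.
Proof.
rewrite /elt_order; case: pselect => [ex|nex].
  case: ex_minnP => n /andP[n0]; rewrite std_expg_eq1.
  case E : (vlab v) => [m|] => [mn min|/eqP n00]; last by rewrite n00 in n0.
  congr Some; apply/eqP; rewrite eqn_leq (dvdn_leq n0 mn) min //.
  by rewrite std_expg_eq1 E dvdnn (ltnW (vlab_ge2 E)).
case E : (vlab v) => [m|//]; case: nex; exists m.
by rewrite std_expg_eq1 E dvdnn (ltnW (vlab_ge2 E)).
Qed.

Lemma std_noncommute u v : edge u v -> ~ commute (x u) (x v).
Proof.
move=> /refl_gen_commute[f nf] uv; apply: nf.
by rewrite -!act_gen -!act_mul uv.
Qed.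

Lemma act_powers v c : powers (x v) c -> c != 1 ->
  exists2 Q : algC, Q != 1%R & forall f, act c f = pseudo_refl v Q f.
Proof.
move=> /powers_expg[n [->|->]] c1.
  exists (mult v ^+ n)%R; last exact: act_expg.
  by rewrite mult_expr_eq1 -std_expg_eq1.
exists (mult v ^- n)%R; last exact: act_expgV.
by rewrite GRing.invr_eq1 mult_expr_eq1 -std_expg_eq1 -invg_eq1.
Qed.

End System.

(** * Ribbons and normalisers *)

Section ConjSet.
Variable D : groupType.
Implicit Types (g h : D) (H K : set D).

Lemma conj_setE g H : conj_set g H = [set h | H (h ^ g)]%classic.
Proof.
apply/seteqP; split=> [_ [h Hh <-]|h /= Hh].
  by rewrite /= conjgE !mulgA mulgVK mulVg mul1g.
by exists (h ^ g) => //; rewrite conjgE !mulgA mulgV mul1g mulgK.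
Qed.

Lemma conj_set_mul g h H : conj_set g (conj_set h H) = conj_set (g * h) H.
Proof. by rewrite !conj_setE; apply/funext => k /=; rewrite conjgM. Qed.

Lemma conj_set_one H : conj_set 1 H = H.
Proof. by rewrite conj_setE; apply/funext => k /=; rewrite conjg1. Qed.

Lemma conj_set_inv g H K : conj_set g H = K -> conj_set g^-1 K = H.
Proof. by move=> <-; rewrite conj_set_mul mulVg conj_set_one. Qed.

Lemma normaliser_subgroup H : is_subgroup (normaliser H).
Proof.
split=> [|g h]; rewrite !inE /normaliser /=; first exact: conj_set_one.
by move=> Hg /conj_set_inv Hh; rewrite -conj_set_mul Hh.
Qed.

Lemma gen_by_subgroup H : is_subgroup (gen_by H).
Proof.
split=> [|g h]; rewrite !inE.
  by move=> K [[K1 _] _]; move: K1; rewrite inE.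
move=> Hg Hh K [Ksub HK]; have [_ Kdiv] := Ksub.
have := Kdiv g h; rewrite !inE; apply.
  by apply: Hg; split.
by apply: Hh; split.
Qed.

Lemma normaliser_subgroup_self H g : is_subgroup H -> H g -> normaliser H g.
Proof.
move=> Hs Hg; have [H1 _] := Hs.
have HM a b : H a -> H b -> H (a * b).
  by move=> Ha Hb; have := group_closedM Hs (x := a) (y := b); rewrite !inE; apply.
have HV a : H a -> H a^-1.
  by move=> Ha; have := group_closedV Hs (x := a); rewrite !inE; apply.
have HJ a b : H a -> H b -> H (a ^ b).
  by move=> Ha Hb; apply: (HM) (HM _ _ Ha Hb); apply: (HV).
rewrite /normaliser /= conj_setE; apply/seteqP; split=> k /= Hk.
  by rewrite -(conjgK g k); apply: (HJ) => //; apply: (HV).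
exact: (HJ).
Qed.

End ConjSet.

Section Ribbons.
Variables (D : groupType) (X : set D) (S : dyer_system X).
Let G := sys_graph S.
Let x (v : G) : D := std v.
Let N : D -> D -> D := @Ncross D X S.
Implicit Types (g h t r s : D) (u v i j k : G) (A B U : {set G}) (Y Z : set D).

Lemma Ncross_cocycle : reflection_cocycle x N.
Proof.
split; [exact: std_inj | exact: std_neq1 | exact: std_generate
  | exact: Ncross_gen | exact: Ncross_mul].
Qed.
Let Nx := Ncross_cocycle.

(* Degree ping-pong: by [refl_cone], an element with first syllable at [u] sends
   the constant function 1 to one whose degree is strictly larger at [v]. *)
Lemma infinite_edge_descent u v g : edge u v -> elab u v = None ->
  N g (x u) != 1 -> N g (x v) = 1.
Proof.
move=> euv luv; pose P : {set G} := [set u; v].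
pose one : G -> {poly algC} := fun=> 1%R.
have cone n h a b : len Nx h < n -> par x P h -> P = [set a; b] ->
    edge a b -> elab a b = None -> N h (x a) != 1 ->
    (size (act h one a) < size (act h one b))%N.
  elim: n h a b => // n IH h a b lh Ph PE eab lab Nh.
  have ba : P = [set b; a] by rewrite PE finset.setUC.
  have eba : edge b a by rewrite edge_sym.
  have lba : elab b a = None by rewrite -(elab_sym eab).
  set c := N h (x a); have ca : powers (x a) c := N_powers Nx _ _.
  have [Q Q1 cQ] := act_powers ca Nh.
  have aP : a \in P by rewrite PE !inE eqxx.
  pose h1 := c^-1 * h; have hE : h = c * h1 by rewrite mulVKg.
  have Ph1 : par x P h1.
    by apply: par_mul => //; apply/par_inv/(par_powers _ ca)/par_gen.
  have Nh1 : N h1 (x a) = 1 := N_strip Nx h a.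
  have lh1 : len Nx h1 < n.
    by have := len_exchange Nx Nh; rewrite -/c -/h1 => /leq_trans; apply; rewrite -ltnS.
  rewrite hE act_mul cQ; suff [fa le] : act h1 one a != 0%R /\
      (size (act h1 one b) <= size (act h1 one a))%N by apply: refl_cone.
  case: (eqVneq h1 1) => [->|h11]; first by rewrite act_one /one GRing.oner_eq0.
  have [i iP Ni] := first_syllable Nx Ph1 h11.
  have ib : i = b.
    move: iP; rewrite PE !inE => /orP[/eqP ia|/eqP //].
    by rewrite ia Nh1 eqxx in Ni.
  rewrite ib in Ni; have lt := IH h1 b a lh1 Ph1 ba eba lba Ni.
  by rewrite -size_poly_gt0 (leq_ltn_trans (leq0n _) lt) (ltnW lt).
move=> Nu; apply/eqP; apply: contraT => Nv.
(* The part of [g] in the subgroup of [u] and [v] crosses the same two generators, and for it the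
   two strict degree inequalities contradict each other. *)
have [h [g' [Ph gm gE]]] := left_decomp Nx P g.
have Nh i : i \in P -> N h (x i) = N g (x i).
  by move=> iP; rewrite gE (N_decomp Nx gm Ph (refl_of_gen x iP)).
have lt1 : (size (act h one u) < size (act h one v))%N.
  by apply: (cone (len Nx h).+1); rewrite // Nh // !inE eqxx.
have lt2 : (size (act h one v) < size (act h one u))%N.
  apply: (cone (len Nx h).+1); rewrite ?Nh ?inE ?eqxx ?orbT //.
  - exact: finset.setUC.
  - by rewrite edge_sym.
  - by rewrite -(elab_sym euv).
by have := ltn_trans lt1 lt2; rewrite ltnn.
Qed.

(** * Translation between subsets of [X] and sets of vertices *)

Definition gens A : set D := [set g | exists2 i, i \in A & g = x i]%classic.
Definition index_set Y : {set G} := [set i | `[< Y (x i) >]].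

Lemma gens_sub A : (gens A `<=` X)%classic.
Proof.
by have [im _ _] := sys_iso_gen S; move=> _ [i _ ->]; apply: im.
Qed.

Lemma gens_index Y : (Y `<=` X)%classic -> gens (index_set Y) = Y.
Proof.
move=> YX; apply/seteqP; split=> [_ [i iY ->]|g Yg].
  by move: iY; rewrite inE => /asboolP.
have [_ _ surj] := sys_iso_gen S; have [i _ ig] := surj g (YX g Yg).
by exists i; rewrite // inE; apply/asboolP; rewrite /x /std ig.
Qed.

Lemma gens_in A i : (x i \in gens A) = (i \in A).
Proof.
apply/idP/idP => [|iA]; last by rewrite inE; exists i.
by rewrite inE => -[j jA /std_inj ->].
Qed.

Lemma gens_memP A i : gens A (x i) <-> i \in A.
Proof. by rewrite -gens_in inE. Qed.

Lemma index_gens A : index_set (gens A) = A.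
Proof.
by apply/setP => i; rewrite inE -gens_in; apply/asboolP/idP; rewrite inE.
Qed.

Lemma gens_setU1 A k : (gens A `|` [set x k])%classic = gens (k |: A).
Proof.
apply/seteqP; split=> [g [[i iA ->]|->]|_ [i + ->]].
- by exists i; rewrite // !inE iA orbT.
- by exists k; rewrite // !inE eqxx.
by rewrite !inE => /orP[/eqP ->|iA]; [right | left; exists i].
Qed.

Lemma gens_setD1 A k : (gens A `\ x k)%classic = gens (A :\ k).
Proof.
apply/seteqP; split=> [_ [[i iA ->] /= ik]|_ [i + ->]].
  by exists i; rewrite // !inE iA andbT; apply/eqP => ik'; apply: ik; rewrite ik'.
rewrite !inE => /andP[ik iA]; split; first by exists i.
by move=> /std_inj ik'; rewrite ik' eqxx in ik.
Qed.

Lemma gen_by_gens A : gen_by (gens A) = [set g | par x A g]%classic.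
Proof.
apply/seteqP; split.
  apply: smallest_sub => [|_ [i iA ->] /=]; last exact: par_gen.
  split=> [|g h]; rewrite !inE /=; first exact: par1.
  by move=> Ag Ah; apply: par_mul => //; apply: par_inv.
have sA := gen_by_subgroup (gens A); have [s1 _] := sA.
have sM := group_closedM sA; have sV := group_closedV sA.
have sg i : i \in A -> x i \in gen_by (gens A).
  by move=> iA; rewrite inE; apply: sub_gen_smallest; exists i.
move=> g /= Ag; suff : g \in gen_by (gens A) by rewrite inE.
elim: Ag => [//|i h iA _ IH|i h iA _ IH]; apply: sM => //; first exact: sg.
exact/sV/sg.
Qed.

Definition full_edge A : rel G := [rel u v | [&& u \in A, v \in A & edge u v]].

Lemma sub_edge_gens A : @sub_edge D X S (gens A) =2 full_edge A.
Proof. by move=> u v; rewrite /sub_edge /full_edge /= -(gens_in A u) -(gens_in A v). Qed.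

Definition conn_comp A k : {set G} := [set u | connect (full_edge (k |: A)) k u].

Lemma component_gens A k : component S (gens A `|` [set x k])%classic (x k) = gens (conn_comp A k).
Proof.
rewrite gens_setU1; apply/seteqP; split=> [_ [u [v [/std_inj -> <- kv]]]|_ [v kv ->]].
  by exists v; rewrite // inE -(eq_connect (sub_edge_gens _)).
by exists k, v; split=> //; rewrite (eq_connect (sub_edge_gens _)); move: kv; rewrite inE.
Qed.

Lemma conn_comp_mem A k : k \in conn_comp A k.
Proof. by rewrite inE connect0. Qed.

Lemma conn_comp_sub A k : conn_comp A k \subset k |: A.
Proof.
apply/fintype.subsetP => i; rewrite inE => /connectP[p].
elim/last_ind: p => [_ ->|p v _]; first by rewrite !inE eqxx.
by rewrite rcons_path last_rcons => /andP[_ /and3P[_ vA _]] ->.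
Qed.

Lemma conn_comp_edge A k i j : i \in conn_comp A k -> j \in A -> edge i j -> j \in conn_comp A k.
Proof.
move=> iC jA ij; have iA := fintype.subsetP (conn_comp_sub A k) _ iC.
move: iC; rewrite !inE => ki; apply: connect_trans ki (connect1 _).
by rewrite /full_edge /= iA ij in_setU1 jA orbT.
Qed.

Lemma conn_comp_commute A k i j : i \in conn_comp A k -> j \in A -> j \notin conn_comp A k ->
  commute (x j) (x i).
Proof.
move=> iC jA jC; apply: std_commute; apply: contraNN jC => ji.
by apply: conn_comp_edge iC jA _; rewrite edge_sym.
Qed.

Lemma conn_comp_connected A k B : B \subset conn_comp A k -> k \notin B ->
  B != finset.set0 ->
  exists b i, [/\ b \in B, i \in conn_comp A k, i \notin B & edge i b].
Proof.
move=> /fintype.subsetP BC kB /set0Pn[b bB].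
suff H p u : u \in conn_comp A k -> u \notin B -> path (full_edge (k |: A)) u p ->
    last u p \in B -> exists b i,
    [/\ b \in B, i \in conn_comp A k, i \notin B & edge i b].
  have := BC _ bB; rewrite inE => /connectP[p pk bl].
  by apply: (H p k) => //; [apply: conn_comp_mem | rewrite -bl].
elim: p u => [|v p IH] u uC uB /=; first by move=> _; rewrite (negPf uB).
move=> /andP[uv pv]; case: (boolP (v \in B)) => vB lB.
  by exists v, u; split=> //; case/and3P: uv.
apply: (IH v) => //; move: uC; rewrite !inE => /connect_trans; apply.
exact: connect1.
Qed.

(** Connectedness, applied to the singleton of [i], gives an edge at [i] inside the component; its
    label is finite, and finite labels join vertices of order 2. *)
Lemma conn_comp_order2 A k : vlab k = Some 2 ->
  (forall u v, u \in conn_comp A k -> v \in conn_comp A k -> edge u v -> elab u v <> None) ->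
  forall i, i \in conn_comp A k -> vlab i = Some 2.
Proof.
move=> k2 fin i iC; case: (eqVneq k i) => [<- //|ki].
have [|||b [j [/set1P-> jC _ ji]]] := @conn_comp_connected A k [set i].
- by rewrite finset.sub1set.
- by rewrite inE.
- by apply/set0Pn; exists i; rewrite inE.
case E : (elab j i) => [n|]; last by case: (fin j i jC iC ji).
by have [] := braid_order2 ji E.
Qed.

Lemma edge_infinite i j : vlab i <> Some 2 -> edge i j -> elab i j = None.
Proof.
move=> i2 ij; have ji : edge j i by rewrite edge_sym.
rewrite (elab_sym ij); apply: dyer_cond ji _; case E : (vlab i) => [n|//].
have := vlab_ge2 E; rewrite leq_eqVlt => /orP[/eqP n2|//].
by case: i2; rewrite E -n2.
Qed.

Lemma conn_comp_set1 A k :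
  (forall j, j \in conn_comp A k -> ~~ edge k j) -> conn_comp A k = [set k].
Proof.
move=> nk; apply/eqP; rewrite finset.eqEsubset finset.sub1set conn_comp_mem andbT.
rewrite -finset.setD_eq0; apply/negPn/negP => ne.
have [|||b [i [bB iC + ib]]] := @conn_comp_connected A k (conn_comp A k :\: [set k]) => //.
- exact: subsetDl.
- by rewrite !inE eqxx.
move: bB; rewrite !inE => /andP[_ bC]; rewrite negb_and negbK => /orP[/eqP ik|].
  by have := nk b; rewrite inE bC -ik ib => /(_ isT).
by move: iC; rewrite inE => ->.
Qed.

(** * Coxeter length, longest elements and spherical type *)

Lemma order2_invol i : vlab i = Some 2 -> x i * x i = 1.
Proof. by move=> /std_expg; rewrite expg2. Qed.

(** When all orders are 2 a syllable is a single letter, so both lengths count the same thing. *)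
Lemma cox_length_gens A g : (forall i, i \in A -> vlab i = Some 2) ->
  par x A g -> cox_length (gens A) g = len Nx g.
Proof.
move=> A2 Ag; have Ai i : i \in A -> x i * x i = 1 by move/A2/order2_invol.
have prod n : is_product (gens A) n g -> len Nx g <= n.
  move=> [s [<- sA ->]].
  have : exists2 s' : seq G, size s' = size s & \prod_(y <- s) y = \prod_(i <- s') x i.
    elim: s sA => [|y s IH] sA; first by exists [::]; rewrite ?big_nil.
    have [|s' ss' es'] := IH; first by move=> z zs; apply: sA; rewrite in_cons zs orbT.
    have [i iA yi] := sA y (mem_head _ _).
    by exists (i :: s'); rewrite /= ?ss' // !big_cons es' yi.
  by case=> s' <- ->; apply: len_prod_gen.
have [s [sA sg sl]] := invol_word Nx Ai Ag.
have prodg : is_product (gens A) (len Nx g) g.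
  exists [seq x i | i <- s]; split; first by rewrite size_map.
    by move=> _ /mapP[i /sA iA ->]; exists i.
  by rewrite big_map.
rewrite /cox_length; case: xgetP => [n _ [/prod ln nmin]|/(_ (len Nx g))[]]; last by split.
by apply/eqP; rewrite eqn_leq ln nmin.
Qed.

(** The witness [a] keeps [xget] from falling back to its default value 1. *)
Lemma longest_elt_gens A a : (forall i, i \in A -> vlab i = Some 2) ->
  longest Nx A a -> longest Nx A (longest_elt (gens A)).
Proof.
move=> A2 [Aa am]; rewrite /longest_elt gen_by_gens.
case: xgetP => [w _ [/= Aw wm]|/(_ a)[]].
  by split=> // g Ag; rewrite -!(cox_length_gens A2) // wm.
by split=> // g /= Ag; rewrite !(cox_length_gens A2) // am.
Qed.

Lemma spherical_gens U : (forall i, i \in U -> vlab i = Some 2) ->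
  (forall i j, i \in U -> j \in U -> edge i j -> elab i j <> None) ->
  (exists n, forall g, par x U g -> len Nx g <= n) -> spherical S (gens U).
Proof.
move=> U2 fin [n bn]; split=> [u v|].
  by rewrite sub_edge_gens => /and3P[uU vU uv]; apply: fin.
have -> : [set y | gens U y /\ elt_order y = Some 2]%classic = gens U.
  apply/seteqP; split=> [y []//|_ [i iU ->]]; split; first by exists i.
  by rewrite elt_order_std U2.
rewrite gen_by_gens; apply: (finite_bounded_par (Nx := Nx)) bn => i iU.
exact/order2_invol/U2.
Qed.

Lemma gens_spherical U : spherical S (gens U) ->
  (forall i, i \in U -> vlab i = Some 2) ->
  exists n, forall g, par x U g -> len Nx g <= n.
Proof.
move=> [_ + U2].
have -> : [set y | gens U y /\ elt_order y = Some 2]%classic = gens U.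
  apply/seteqP; split=> [y []//|_ [i iU ->]]; split; first by exists i.
  by rewrite elt_order_std U2.
rewrite gen_by_gens; exact: bounded_finite_par.
Qed.

Lemma spherical_edge U u v : spherical S (gens U) -> u \in U -> v \in U ->
  edge u v -> elab u v <> None.
Proof.
by move=> [fin _] uU vU uv; apply: fin; rewrite sub_edge_gens /full_edge /= uU vU.
Qed.

Lemma ribbon_elt_gens A k : ribbon_elt S (gens A) (x k) =
  if vlab k == Some 2 then
    (longest_elt (gens (conn_comp A k)))^-1 * longest_elt (gens (conn_comp A k :\ k))
  else x k.
Proof. by rewrite /ribbon_elt component_gens gens_setD1 elt_order_std. Qed.

(* Every ribbon satisfies this; minimality in its coset is what makes it trivial
   once it lies in [gen_by Y]. *)
Definition min_conj Y Z r := [/\ (Y `<=` X)%classic, (Z `<=` X)%classic,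
  left_min x N (index_set Y) r^-1 & conj_set r (gen_by Y) = gen_by Z].

Lemma gen_by_index Y : (Y `<=` X)%classic ->
  gen_by Y = [set g | par x (index_set Y) g]%classic.
Proof. by move=> YX; rewrite -gen_by_gens gens_index. Qed.

Lemma conj_set_par Y Z r : (Y `<=` X)%classic -> (Z `<=` X)%classic ->
  conj_set r (gen_by Y) = gen_by Z ->
  (forall g, par x (index_set Y) g -> par x (index_set Z) (g ^ r^-1)) /\
  (forall g, par x (index_set Z) g -> par x (index_set Y) (g ^ r)).
Proof.
move=> YX ZX; rewrite conj_setE !gen_by_index // => e.
have e' g : par x (index_set Y) (g ^ r) <-> par x (index_set Z) g.
  by have := congr1 (fun K : set D => K g) e => /= ->.
by split=> g; rewrite -e' ?conjgKV.
Qed.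

Lemma min_conj_one Y : (Y `<=` X)%classic -> min_conj Y Y 1.
Proof.
move=> YX; split=> //; last exact: conj_set_one.
by move=> t _; rewrite invg1 (N_one Nx).
Qed.

Lemma min_conj_inv Y Z r : min_conj Y Z r -> min_conj Z Y r^-1.
Proof.
move=> [YX ZX rm rYZ]; split=> //; last exact: conj_set_inv.
apply: (left_min_inv Nx rm) => g; rewrite invgK.
by have [_] := conj_set_par YX ZX rYZ; apply.
Qed.

Lemma min_conj_mul Y Z W r s : min_conj Y Z r -> min_conj Z W s -> min_conj Y W (s * r).
Proof.
move=> [YX ZX rm rYZ] [_ WX sm sZW]; split=> //; last first.
  by rewrite -conj_set_mul rYZ.
have [YZ _] := conj_set_par YX ZX rYZ.
move=> t Yt; rewrite invgM (cocycle_mul Nx) rm // mul1g sm ?conj1g //.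
have : par x (index_set Z) (t ^ r^-1) by apply/YZ/refl_of_par.
case: Yt => h [i [_ _ ->]]; rewrite -conjgM; exact: (par_refl Nx).
Qed.

Lemma min_conj_direct Y Z r : direct_ribbon S Y Z r -> min_conj Y Z r.
Proof.
move=> [y [[YX [Xy Yy]] sph ZYy rYZ ->]].
have [_ _ surj] := sys_iso_gen S; have [k _ ky] := surj y Xy.
have {}ky : x k = y by [].
set A := index_set Y; have YA : gens A = Y by apply: gens_index.
have kA : k \notin A by rewrite inE; apply/asboolP; rewrite ky.
split=> // [z /ZYy[/YX//|->//]|].
rewrite -ky -YA index_gens ribbon_elt_gens; rewrite -ky -YA component_gens in sph.
have CA := fintype.subsetP (conn_comp_sub A k).
case: eqP => [k2|k2]; last first.
  apply: (left_minP Nx) => i iA.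
  rewrite (N_power_gen Nx _ (powers_idV (x k))); case: eqP => // /std_inj ik.
  by rewrite -ik iA in kA.
have U2 := conn_comp_order2 k2 (fun u v => @spherical_edge _ u v sph).
have [n bn] := gens_spherical sph U2.
set U := conn_comp A k in U2 bn *; have JU : U :\ k \subset U by apply: subsetDl.
have J2 i : i \in U :\ k -> vlab i = Some 2 by move/(fintype.subsetP JU)/U2.
have [a0 al0] := longest_exists bn.
have [b0 bl0] := longest_exists (fun g Jg => bn g (par_sub JU Jg)).
have al := longest_elt_gens U2 al0; have bl := longest_elt_gens J2 bl0.
set a := longest_elt _ in al *; set b := longest_elt _ in bl *.
have Ui i (iU : i \in U) := order2_invol (U2 i iU).
have Ji i (iJ : i \in U :\ k) := order2_invol (J2 i iJ).
rewrite invgM invgK (longest_inv Ji bl); have [Ua _] := al; have [Jb _] := bl.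
have Ub := par_sub JU Jb.
apply: (left_minP Nx) => i iA; case: (boolP (i \in U)) => iU; last first.
  apply: (N_par1 Nx (par_mul Ub Ua)) => /refl_of_par/(par_gen_mem Nx).
  by rewrite (negPf iU).
have iJ : i \in U :\ k.
  by rewrite in_setD1 iU andbT; apply: contraNneq kA => <-.
(* Both [b] and [a] cross this wall, and their contributions multiply to [x i * x i = 1]. *)
rewrite (cocycle_mul Nx) (longest_N Ji bl (refl_of_gen x iJ)).
rewrite (longest_N Ui al) ?conjgK ?Ui //.
by apply: refl_of_conj => //; apply: refl_of_gen.
Qed.

Lemma min_conj_elem Y Z r : elem_ribbon S Y Z r -> min_conj Y Z r.
Proof. by case=> /min_conj_direct // /min_conj_inv; rewrite invgK. Qed.

Lemma min_conj_ribbon Y Z r : is_ribbon S Y Z r -> min_conj Y Z r.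
Proof.
elim=> {Y Z r} [Y /min_conj_one //|Y Z W r s _ IH /min_conj_elem].
exact: min_conj_mul IH.
Qed.

Lemma ribbon_trans Y Z W r s : is_ribbon S Y Z r -> is_ribbon S Z W s ->
  is_ribbon S Y W (s * r).
Proof.
move=> YZ ZW; elim: ZW YZ => {Z W s} [Z _|Z W W' s t _ IH e /IH].
  by rewrite mul1g.
by rewrite -mulgA => /ribbon_step; apply.
Qed.

Lemma ribbon_elem Y Z r : elem_ribbon S Y Z r -> is_ribbon S Y Z r.
Proof.
move=> e; have [YX _ _ _] := min_conj_elem e.
by rewrite -[r]mulg1; apply: ribbon_step e; apply: ribbon_one.
Qed.

Lemma ribbon_inv Y Z r : is_ribbon S Y Z r -> is_ribbon S Z Y r^-1.
Proof.
elim=> {Y Z r} [Y YX|Y Z W r s _ IH e].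
  by rewrite invg1; apply: ribbon_one.
rewrite invgM; apply: ribbon_trans IH; apply: ribbon_elem.
by case: e => e; [right; rewrite invgK | left].
Qed.

Lemma conj_set_gens A B r : maps_gens x A B r^-1 -> maps_gens x B A r ->
  conj_set r (gen_by (gens A)) = gen_by (gens B).
Proof.
move=> AB BA; rewrite conj_setE !gen_by_gens; apply/seteqP; split=> g /= Hg.
  by rewrite -(conjgK r g); apply: par_conj_map Hg => i /AB[j jB ->]; apply: par_gen.
by apply: par_conj_map Hg => i /BA[j jB ->]; apply: par_gen.
Qed.

(** * Elementary steps are ribbons *)

Section ElementaryRibbon.
Variables (A B : {set G}) (k : G) (v : D).
Let U := conn_comp A k.
Hypotheses (kA : k \notin A) (Uv : par x U v) (v1 : v != 1).
Hypotheses (vm : left_min x N A v^-1) (vU : maps_gens x (A :&: U) U v^-1).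
Hypotheses (AB : maps_gens x A B v^-1) (BA : maps_gens x B A v).

Let kU : k \in U := conn_comp_mem A k.

Let memJ i : i \in U :\ k -> i \in A :&: U.
Proof.
rewrite in_setD1 finset.in_setI => /andP[ik iU]; rewrite iU andbT.
by have := fintype.subsetP (conn_comp_sub A k) i iU; rewrite in_setU1 (negPf ik).
Qed.

Let vJ : left_min x N (U :\ k) v^-1.
Proof.
apply: left_min_sub vm; apply/fintype.subsetP => i /memJ.
by rewrite finset.in_setI => /andP[].
Qed.

Let v_map j : j \in U :\ k -> exists2 l, l \in U & x j ^ v^-1 = x l.
Proof. by move/memJ/vU. Qed.

Lemma elementary_edge j : j \in U -> edge k j -> elab k j <> None.
Proof.
move=> jU kj /(infinite_edge_descent kj) inf.
have jJ : j \in U :\ k.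
  by rewrite in_setD1 jU andbT; apply: contraTneq kj => ->; rewrite edge_irr.
have [g [Nj Nk]] := step_two_descents Nx Uv v1 vJ v_map jJ.
by rewrite inf ?eqxx in Nj.
Qed.

Lemma direct_ribbon_gens (C : {set G}) r : spherical S (gens U) -> C \subset k |: A ->
  r = ribbon_elt S (gens A) (x k) ->
  conj_set r (gen_by (gens A)) = gen_by (gens C) ->
  direct_ribbon S (gens A) (gens C) r.
Proof.
move=> sph CA rE rAC; exists (x k); split=> //.
- split; first exact: gens_sub.
  split; first by apply: (@gens_sub [set k]); exists k; rewrite ?inE.
  by move/gens_memP; rewrite (negPf kA).
- by rewrite component_gens.
- rewrite gens_setU1 => _ [i iC ->]; exists i => //.
  exact: (fintype.subsetP CA).
- by rewrite -rE.
Qed.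

Lemma elementary_ribbon_order2 : vlab k = Some 2 ->
  is_ribbon S (gens A) (gens B) v.
Proof.
move=> k2; have k_invol := order2_invol k2.
have conn (C : {set G}) : C \subset U -> k \notin C -> C != finset.set0 ->
    exists b i, [/\ b \in C, i \in U, i \notin C & ~ commute (x i) (x b)].
  move=> CU kC C0; have [b [i [bC iU iC ib]]] := conn_comp_connected CU kC C0.
  by exists b, i; split=> //; apply: std_noncommute.
have [n bn] := step_bounded Nx kU Uv v1 vJ v_map k_invol conn.
have [a0 al0] := longest_exists bn.
have JU : U :\ k \subset U by apply: subsetDl.
have [b0 bl0] := longest_exists (fun g Jg => bn g (par_sub JU Jg)).
(* Only [k] is known to have order 2 so far. A longest element crosses every generator of [U], which
   no infinite edge permits; finite labels then spread order 2 over the component. *)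
have fin i j : i \in U -> j \in U -> edge i j -> elab i j <> None.
  move=> iU jU ij /(infinite_edge_descent ij) inf.
  have := longest_descent al0 jU.
  by rewrite inf ?eqxx //; apply: longest_descent al0 iU.
have U2 := conn_comp_order2 k2 fin.
have J2 i : i \in U :\ k -> vlab i = Some 2 by move/(fintype.subsetP JU)/U2.
have al := longest_elt_gens U2 al0; have bl := longest_elt_gens J2 bl0.
apply/ribbon_elem; left; apply: direct_ribbon_gens.
- by apply: spherical_gens => //; exists n.
- apply/fintype.subsetP => j /BA[i iA ji].
  case: (boolP (i \in U)) => iU.
    have [|l lU il] := vU (i := i); first by rewrite finset.in_setI iA.
    have -> : j = l by apply: (@std_inj _ _ S); rewrite -/(x j) -/(x l) -il -ji conjgK.
    exact: (fintype.subsetP (conn_comp_sub A k)).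
  have -> : j = i.
    apply: (@std_inj _ _ S); apply: (conjg_inj v); rewrite -/(x j) -/(x i) ji.
    apply/esym/commute_conj; apply: (par_commute _ Uv) => l lU.
    exact: conn_comp_commute lU iA iU.
  by rewrite in_setU1 iA orbT.
- rewrite ribbon_elt_gens k2 eqxx; apply: (step_longest (Nx := Nx)) al bl => //.
    by move=> i /U2/order2_invol.
  exact: (step_refl Nx Uv v1 vJ v_map k_invol).
exact: conj_set_gens.
Qed.

(** An edge at [k] would carry the label infinity, which [elementary_edge] forbids inside [U]. So
    [U] is the point [k], and [v] is a power of [x k], each factor being an elementary ribbon or its
    inverse. *)
Lemma elementary_ribbon_order_gt2 : vlab k <> Some 2 ->
  is_ribbon S (gens A) (gens B) v.
Proof.
move=> k2; have UE : U = [set k].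
  apply: conn_comp_set1 => j jU; apply/negP => kj.
  by apply: (elementary_edge jU kj); apply: edge_infinite.
have kcomm i : i \in A -> commute (x i) (x k).
  move=> iA; apply: (conn_comp_commute kU iA); rewrite -/U UE inE.
  by apply: contraTneq iA => ->.
have pv : powers (x k) v by apply: par_set1; rewrite -UE.
have Av i : i \in A -> x i ^ v = x i.
  move=> iA; apply: commute_conj; apply: (par_commute _ Uv) => j.
  by rewrite UE => /set1P ->; apply: kcomm.
have <- : A = B.
  apply/setP => i; apply/idP/idP => [iA|/BA[j jA]].
    have [j jB] := AB iA; rewrite -{1}(Av i iA) conjgK => /std_inj ->.
    by [].
  by rewrite -{1}(Av j jA) => /conjg_inj/std_inj ->.
have dir : direct_ribbon S (gens A) (gens A) (x k).
  apply: direct_ribbon_gens.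
  - rewrite UE; split=> [i j|].
      by rewrite sub_edge_gens => /and3P[/set1P -> /set1P ->]; rewrite edge_irr.
    (* No generator in [U] has order 2, so the subgroup that must be finite is trivial. *)
    apply: (sub_finite_set _ (finite_set1 (1 : D))).
    apply: smallest_sub => [|_ [[i /set1P -> ->]]].
      by split=> [|g h]; rewrite !inE //= => -> ->; rewrite mulgV.
    by rewrite elt_order_std.
  - exact: finset.subsetUr.
  - by rewrite ribbon_elt_gens; case: eqP.
  apply: conj_set_gens => i iA; exists i => //; apply: commute_conj.
    by apply: commuteV; apply: kcomm.
  exact: kcomm.
elim: pv => [|e _ IH|e _ IH].
- by apply: ribbon_one; apply: gens_sub.
- by apply: ribbon_step IH _; left.
by apply: ribbon_step IH _; right; rewrite invgK.
Qed.

End ElementaryRibbon.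

Lemma elementary_ribbon A B k (v : D) : k \notin A -> par x (conn_comp A k) v -> v != 1 ->
  left_min x N A v^-1 -> maps_gens x (A :&: conn_comp A k) (conn_comp A k) v^-1 ->
  maps_gens x A B v^-1 -> maps_gens x B A v ->
  is_ribbon S (gens A) (gens B) v.
Proof.
move=> kA Uv v1 vm vU AB BA; case: (eqVneq (vlab k) (Some 2)) => [k2|/eqP k2].
  exact: (elementary_ribbon_order2 kA).
exact: (elementary_ribbon_order_gt2 kA).
Qed.

(** With [min_conj_ribbon] this characterises ribbons as the conjugators from [gen_by Y] to
    [gen_by Z] that are shortest in their coset. *)
Lemma ribbon_of_left_min Y Z r : (Y `<=` X)%classic -> (Z `<=` X)%classic ->
  left_min x N (index_set Y) r^-1 -> conj_set r (gen_by Y) = gen_by Z ->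
  is_ribbon S Y Z r.
Proof.
move=> YX ZX rm rYZ; have [YZ ZY] := conj_set_par YX ZX rYZ.
have ZY' g : par x (index_set Z) g -> par x (index_set Y) (g ^ r^-1^-1).
  by rewrite invgK; apply: ZY.
rewrite -(gens_index YX) -(gens_index ZX).
apply: (ribbon_decomposition Nx (Rb := fun A B => is_ribbon S (gens A) (gens B))
  conn_comp_mem conn_comp_commute) => //.
- by move=> A; apply: ribbon_one; apply: gens_sub.
- by move=> A B C s t; apply: ribbon_trans.
- exact: elementary_ribbon.
- exact: (left_min_maps_gens Nx rm YZ ZY').
rewrite -[r]invgK; apply: (left_min_maps_gens Nx) => //.
  exact: (left_min_inv Nx rm ZY').
by move=> g; rewrite !invgK; apply: YZ.
Qed.

(** A ribbon inside [gen_by Y] is trivial by minimality. The shortest element of [g] times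
    [gen_by Y] still normalises, hence is a ribbon, and conjugation by it moves the remaining factor
    to the left. *)
Lemma normaliser_semidirect Y : (Y `<=` X)%classic ->
  internal_semidirect (normaliser (gen_by Y)) (gen_by Y) (Ribb S Y Y).
Proof.
move=> YX; have sY := gen_by_subgroup Y; have sN := normaliser_subgroup (gen_by Y).
have YN : (gen_by Y `<=` normaliser (gen_by Y))%classic.
  by move=> g; apply: normaliser_subgroup_self.
have RN : (Ribb S Y Y `<=` normaliser (gen_by Y))%classic.
  by move=> r /min_conj_ribbon[].
split=> //.
- split=> //; split=> [|r s]; rewrite !inE /Ribb /=; first exact: ribbon_one.
  by move=> rY /ribbon_inv sY'; apply: ribbon_trans sY' rY.
split.
  apply/seteqP; split=> [r [Yr /min_conj_ribbon[_ _ rm _]]|_ ->].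
    rewrite gen_by_index //= in Yr.
    by apply: invg_inj; rewrite invg1; apply: (left_min_par Nx) rm; apply: par_inv.
  by split; [have [] := sY; rewrite inE | apply: ribbon_one].
apply/seteqP; split=> [g Ng|_ [h Yh [r Rr <-]]]; last first.
  have := group_closedM sN (x := h) (y := r); rewrite !inE; apply.
    exact: YN.
  exact: RN.
have [h [u [Yh um gE]]] := left_decomp Nx (index_set Y) g^-1.
have {}gE : g = u^-1 * h^-1 by rewrite -invgM -gE invgK.
have Ru : Ribb S Y Y u^-1.
  apply: ribbon_of_left_min; rewrite ?invgK //.
  have hY : conj_set h (gen_by Y) = gen_by Y by apply: YN; rewrite gen_by_index.
  have -> : u^-1 = g * h by rewrite gE mulgVK.
  by rewrite -conj_set_mul hY.
have Yh' : gen_by Y (h^-1 ^ u).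
  have := RN _ Ru; rewrite /normaliser /= conj_setE => uY.
  by rewrite -uY /= conjgK gen_by_index //; apply: par_inv.
by exists (h^-1 ^ u) => //; exists u^-1; rewrite // gE conjgE mulgA mulgK.
Qed.

End Ribbons.

Local Open Scope classical_set_scope.

Theorem corollaryC (D : groupType) (X : set D) (S : dyer_system X) (Y : set D)
    (hY : Y `<=` X) :
  internal_semidirect (normaliser (gen_by Y)) (gen_by Y) (Ribb S Y Y).
Proof. exact: normaliser_semidirect. Qed.
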